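(* Consider the KRW system (for any $\epsilon\in(0,\infty)$) and the DRC system (for any $\epsilon,\kappa\in(0,\infty)$) with $\boldsymbol\omega=\mathbf 0$. In each case, all elements of $\mathcal{S}$ except for $\mathbf 0$ (up to a global translation, i.e. except for the points all of whose components coincide) are weakly unstable, while $\mathbf 0$ is asymptotically stable.
   Context: Skeleton. $\mathbb{G}=(V,E)$ is a finite connected graph with symmetric weights $\pi(u,v)=\pi(v,u)\in[0,\infty)$ for $u,v\in V$; the edges are the (unordered) pairs $\{u,v\}$ (possibly $u=v$) with $\pi(u,v)>0$. Put $\pi(u)=\sum_{v\in V}\pi(u,v)>0$. $K>0$ is a constant, $N\ge2$ an integer. $\mathbb{T}^n=(\mathbb{R}/2\pi\mathbb{Z})^n$. Absolute values of elements and of differences of elements of $\mathbb{T}$ denote geodesic distance (to $0$, resp. to each other) in $[0,\pi]$. Kuramoto Random Walk (KRW). Assume in addition that every vertex has a self-loop: $\pi(u,u)>0$ for all $u\in V$. For $\epsilon\in(0,\infty)$, $\mathbf X^\epsilon(t)=(X^\epsilon_1(t),\dots,X^\epsilon_N(t))$ consists of $N$ independent continuous-time random walks on $\mathbb{G}$: each walk jumps at constant rate $\epsilon^{-1}$, and from $u$ it jumps to $v$ with probability $\pi(u,v)/\pi(u)$. The starting point $\mathbf X^\epsilon(0)=\mathbf x_0^\epsilon\in V^N$ is given. With $a_{ij}(\mathbf x)=\pi(x_i,x_j)$ for $\mathbf x\in V^N$, the KRW system for $\boldsymbol\theta^\epsilon(t)\in\mathbb{T}^N$ with $\boldsymbol\omega=\mathbf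 0$ is $$\frac{d}{dt}\theta^\epsilon_i(t)=\frac{K}{N}\sum_{j=1}^N a_{ij}(\mathbf X^\epsilon(t))\sin\big(\theta^\epsilon_j(t)-\theta^\epsilon_i(t)\big),\quad i=1,\dots,N.$$ Kuramoto model on the Dynamic Random Conductance Model (DRC). For $\epsilon,\kappa>0$, each edge $e\in E$ carries an independent continuous-time Markov chain $(e^{\epsilon,\kappa}(t))_{t\ge0}$ on $\{0,1\}$, which jumps from $1$ to $0$ at rate $\epsilon^{-1}$ and from $0$ to $1$ at rate $\kappa$, started at $e^{\epsilon,\kappa}(0)=1$. Let $\mathcal{E}^{\epsilon,\kappa}(t)=\{e\in E:e^{\epsilon,\kappa}(t)=1\}$ and $a_{uv}(\mathcal{E})=1_{\{\{u,v\}\in\mathcal{E}\}}\pi(u,v)$ for $\mathcal{E}\subset E$. The DRC system for $\boldsymbol\theta^{\epsilon,\kappa}(t)\in\mathbb{T}^{|V|}$ with $\boldsymbol\omega=\mathbf 0$ is $$\frac{d}{dt}\theta^{\epsilon,\kappa}_u(t)=\frac{K}{|V|}\sum_{v\in V}a_{uv}(\mathcal{E}^{\epsilon,\kappa}(t))\sin\big(\theta^{\epsilon,\kappa}_v(t)-\theta^{\epsilon,\kappa}_u(t)\big),\quad u\in V.$$ The set $\mathcal{S}$. $\mathcal{S}=\{\boldsymbol\theta:\ |\theta_i-\theta_j|\in\{0,\pi\}\ \forall\, i,j\}$, a subset of $\mathbb{T}^N$ for KRW and of $\mathbb{T}^{|V|}$ for DRC (indices $i,j$ then range over $V$). Up to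 a global translation (adding the same element of $\mathbb{T}$ to all components) it is $\{\boldsymbol\theta:\theta_i\in\{0,\pi\}\ \forall i\}$. All elements of $\mathcal S$ are zeros of the right-hand sides at all times. Stability notions (stated for KRW; for DRC replace $\boldsymbol\theta^\epsilon$ by $\boldsymbol\theta^{\epsilon,\kappa}$). Let $\|\boldsymbol\theta\|=\max_i|\theta_i|$. (a) $\boldsymbol\theta^\star\in\mathcal{S}$ is asymptotically stable if there exists $\delta>0$ such that for any $t_0\ge0$, $\mathbb{P}$-a.s.: $\|\boldsymbol\theta^\epsilon(t_0)-\boldsymbol\theta^\star\|<\delta$ implies $\lim_{t\to\infty}\boldsymbol\theta^\epsilon(t)=\boldsymbol\theta^\star$ up to a global translation (i.e. for some $c\in\mathbb{T}$, $\theta^\epsilon_i(t)\to\theta^\star_i+c$ for every $i$). Here $\boldsymbol\theta^\epsilon$ is the solution on $[t_0,\infty)$ with the given value at time $t_0$. (b) $\boldsymbol\theta^\star\in\mathcal{S}$ is weakly unstable if there exists $\delta>0$ such that for any $\iota>0$, $\mathbb{P}$-a.s. there exist $t_0\ge0$ and an initial condition $\boldsymbol\theta^\epsilon(t_0)$ at time $t_0$ with $\|\boldsymbol\theta^\epsilon(t_0)-\boldsymbol\theta^\star\|<\iota$ such that the solution on $[t_0,\infty)$ started from it satisfies $\sup_{t\ge t_0}\|\boldsymbol\theta^\epsilon(t)-\boldsymbol\theta^\star\|>\delta$. (Both $t_0$ and the initial condition may depend on the realization.) *)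

(* Defs.v *)
From HB Require Import structures.
From mathcomp Require Import all_boot all_order all_algebra.
From mathcomp Require Import all_classical all_reals all_analysis.
Set Implicit Arguments.
Unset Strict Implicit.
Unset Printing Implicit Defensive.
Import Order.TTheory GRing.Theory Num.Theory.
Import numFieldNormedType.Exports.
Local Open Scope classical_set_scope.
Local Open Scope ring_scope.

(** * The circle R / 2 pi Z *)

Definition period_lattice (R : realType) : {pred R} :=
  fun x => x / (pi *+ 2) \is a Num.int.

Lemma period_lattice_zmod_closed (R : realType) :
  zmod_closed (@period_lattice R).
Proof.
split=> [|x y xZ yZ]; rewrite unfold_in; first by rewrite mul0r rpred0.
by rewrite mulrBl; apply: rpredB.
Qed.

HB.instance Definition _ (R : realType) :=
  GRing.isZmodClosed.Build R (@period_lattice R)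
    (@period_lattice_zmod_closed R).

Definition circle (R : realType) := (Quotient.quot (@period_lattice R)).

Definition angle {R : realType} (x : R) : circle R :=
  (\pi_(Quotient.quot (@period_lattice R)) x)%qT.

(* The geodesic distance to 0, i.e. the quotient norm: the least absolute value
   of a real representative.  The distance from a to b is [geo (a - b)]. *)
Definition geo {R : realType} (a : circle R) : R :=
  inf [set `|x| | x in [set x : R | angle x = a]].

Definition circle_sin {R : realType} (a : circle R) : R :=
  sin (repr (a : Quotient.quot (@period_lattice R))).

Lemma circle_sinE (R : realType) (x : R) : circle_sin (angle x) = sin x.
Proof.
rewrite /circle_sin /angle.
set y := repr _.
have : (y == x %[mod Quotient.quot (@period_lattice R)])%qT by rewrite reprK.
rewrite -Quotient.idealrBE unfold_in => /intrP[m ym].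
have pi2 : (pi *+ 2 : R) != 0 by rewrite mulrn_eq0 /= gt_eqF // pi_gt0.
have -> : y = x + m%:~R * (pi *+ 2) by rewrite -ym mulfVK // addrC subrK.
case: m {ym} => n.
  by rewrite -pmulrn mulr_natl (periodicn (@sinD2pi R)).
rewrite NegzE mulrNz mulNr -pmulrn mulr_natl.
by rewrite -[LHS](periodicn (@sinD2pi R) n.+1) subrK.
Qed.

Definition max_norm {R : realType} {I : finType} (th : I -> circle R) : R :=
  \big[Num.max/0]_i geo (th i).

Definition max_dist {R : realType} {I : finType} (th th' : I -> circle R) : R :=
  max_norm (fun i => th i - th' i).

(** * Finite-state continuous-time Markov chains *)

Section MarkovChains.
Context {R : realType}.

(* A diagonal rate [rate x x] cancels out: jumping from x to x is invisible. *)
Definition generator {S : finType} (rate : S -> S -> R) (x y : S) : R :=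
  rate x y - (x == y)%:R * \sum_z rate x z.

Definition is_transition_semigroup {S : finType} (rate : S -> S -> R)
    (p : R -> S -> S -> R) : Prop :=
  [/\ forall (t : R) x y, 0 <= t -> 0 <= p t x y,
      forall (t : R) x, 0 <= t -> \sum_y p t x y = 1,
      forall x y, p 0 x y = (x == y)%:R,
      forall (s t : R) x y, 0 <= s -> 0 <= t ->
        p (s + t) x y = \sum_z p s x z * p t z y
    & forall x y,
        (p h x y - (x == y)%:R) / h @[h --> 0^'+] --> generator rate x y].

(* The probability of being at y1 at time t1, at y2 at time t2, ..., for
   [l = [:: (t1, y1); (t2, y2); ...]] with t <= t1 <= t2 <= ..., when starting
   from x at time t. *)
Fixpoint path_proba {S : finType} (p : R -> S -> S -> R) (t : R) (x : S)
    (l : seq (R * S)) : R :=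
  if l is (u, y) :: l' then p (u - t) x y * path_proba p u y l' else 1.

Definition visits {S : finType} {T : Type} (X : R -> T -> S)
    (l : seq (R * S)) : set T :=
  [set om | forall c, c \in l -> X c.1 om = c.2].

Definition cadlag_path {S : finType} (f : R -> S) : Prop :=
  forall t : R, 0 <= t ->
    (\forall s \near t^'+, f s = f t) /\
    (0 < t -> exists x, \forall s \near t^'-, f s = x).

(* Only times t >= 0 are relevant. *)
Definition is_markov_chain {d : measure_display} {T : measurableType d}
    (P : probability T R) {S : finType} (rate : S -> S -> R) (x0 : S)
    (X : R -> T -> S) : Prop :=
  [/\ forall (t : R) x, 0 <= t -> measurable [set om | X t om = x],
      {ae P, forall om, cadlag_path (fun t => X t om)}
    & exists2 p, is_transition_semigroup rate p &
        forall l : seq (R * S), path <=%R 0 [seq c.1 | c <- l] ->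
          P (visits X l) = (path_proba p 0 x0 l)%:E].

(* Mutual independence of the processes X_j, j in D, through the pi-systems of
   cylinder sets; [l j = [::]] gives the sure event, so that all subfamilies of D
   are covered. *)
Definition independent_processes {d : measure_display} {T : measurableType d}
    (P : probability T R) {J S : finType} (D : {set J})
    (X : J -> R -> T -> S) : Prop :=
  forall l : J -> seq (R * S),
    (forall j c, c \in l j -> 0 <= c.1) ->
    P [set om | forall j, j \in D -> visits (X j) (l j) om] =
    (\prod_(j in D) P (visits (X j) (l j)))%E.

End MarkovChains.

(** * The Kuramoto system with vanishing natural frequencies *)

Section Kuramoto.
Context {R : realType} {I : finType}.

Definition kuramoto_field (K : R) (a : I -> I -> R) (th : I -> circle R)
    (i : I) : R :=
  K / #|I|%:R * \sum_j a i j * circle_sin (th j - th i).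

(* [th] solves the system with coupling [A] on [t0, +oo[.  A curve on the torus
   is differentiated through a continuous lift [phi] to the reals.  For a
   piecewise constant [A] the curve is continuous, and the differential equation
   is required at all times but the jump times of [A]. *)
Definition kuramoto_solution (K : R) (A : R -> I -> I -> R) (t0 : R)
    (th : R -> I -> circle R) : Prop :=
  exists phi : I -> R -> R,
    [/\ forall i (t : R), t0 <= t -> th t i = angle (phi i t),
        forall i, {within `[t0, +oo[, continuous (phi i)}
      & forall i (t : R), t0 < t ->
          (\forall s \near t, forall j k, A s j k = A t j k) ->
          is_derive t 1 (phi i) (kuramoto_field K (A t) (th t) i)].

Definition phase_locked : set (I -> circle R) :=
  [set th | forall i j, geo (th i - th j) = 0 \/ geo (th i - th j) = pi].

Context {d : measure_display} {T : measurableType d}.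

Definition asymptotically_stable (P : probability T R) (K : R)
    (A : T -> R -> I -> I -> R) (th_star : I -> circle R) : Prop :=
  exists2 delta : R, 0 < delta &
    forall t0 : R, 0 <= t0 ->
      {ae P, forall om, forall th : R -> I -> circle R,
        kuramoto_solution K (A om) t0 th ->
        max_dist (th t0) th_star < delta ->
        exists c : circle R, forall i,
          geo (th t i - (th_star i + c)) @[t --> +oo] --> (0 : R)}.

Definition weakly_unstable (P : probability T R) (K : R)
    (A : T -> R -> I -> I -> R) (th_star : I -> circle R) : Prop :=
  exists2 delta : R, 0 < delta &
    forall iota : R, 0 < iota ->
      {ae P, forall om, exists t0 : R, exists th : R -> I -> circle R,
        [/\ 0 <= t0,
            kuramoto_solution K (A om) t0 th,
            max_dist (th t0) th_star < iota
          & delta < sup [set max_dist (th t) th_star | t in `[t0, +oo[]]}.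

End Kuramoto.

(** * The two models on a weighted graph *)

Section Models.
Context {R : realType} {V : finType}.
Implicit Types (w : V -> V -> R).

Definition is_weighted_graph w : Prop :=
  [/\ forall u v, w u v = w v u,
      forall u v, 0 <= w u v,
      forall u, 0 < \sum_v w u v
    & forall u v, connect (fun x y => 0 < w x y) u v].

Definition edges w : {set {set V}} :=
  [set e : {set V} |
    [exists u, exists v, (e == [set u; v]) && (0 < w u v)]]%SET.

Definition walk_rate w (eps : R) (u v : V) : R :=
  eps^-1 * (w u v / \sum_z w u z).

Definition edge_rate (eps kappa : R) (b b' : bool) : R :=
  match b, b' with
  | true, false => eps^-1
  | false, true => kappa
  | _, _ => 0
  end.

Context {d : measure_display} {T : measurableType d}.

Definition is_KRW (P : probability T R) w (eps : R) (N : nat)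
    (x0 : 'I_N -> V) (X : 'I_N -> R -> T -> V) : Prop :=
  (forall i, is_markov_chain P (walk_rate w eps) (x0 i) (X i)) /\
  independent_processes P [set: 'I_N]%SET X.

Definition KRW_coupling w (N : nat) (X : 'I_N -> R -> T -> V)
    (om : T) (t : R) (i j : 'I_N) : R :=
  w (X i t om) (X j t om).

(* [Y e] is the chain carried by the edge e; it is unconstrained when e is not
   an edge. *)
Definition is_DRC (P : probability T R) w (eps kappa : R)
    (Y : {set V} -> R -> T -> bool) : Prop :=
  (forall e, e \in edges w ->
     is_markov_chain P (edge_rate eps kappa) true (Y e)) /\
  independent_processes P (edges w) Y.

Definition open_edges w (Y : {set V} -> R -> T -> bool) (om : T) (t : R)
    : {set {set V}} :=
  [set e in edges w | Y e t om]%SET.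

Definition DRC_coupling w (Y : {set V} -> R -> T -> bool)
    (om : T) (t : R) (u v : V) : R :=
  ([set u; v]%SET \in open_edges w Y om t)%:R * w u v.

End Models.

(* Main.v *)
(**
Almost surely, for every L there are arbitrarily late time intervals of length L
during which the coupling equals one fixed connected symmetric matrix M: all the
walkers sit at one given vertex (M constant), or all the edges are open (M = w).
Indeed, the driving chains are irreducible and leave a state at bounded rate, so
that each block of length 1 + L succeeds with conditional probability bounded
below.

Near 0, the angles lift to reals whose sum is conserved (the coupling is
symmetric and sin is odd), and the variance is nonincreasing for any coupling.
While the coupling is M and the variance is at least e > 0, the variance
decreases at a speed bounded below; a long enough interval brings it under e.

Near a phase-locked point with two clusters, the linearization for the coupling M
is a symmetric matrix J with <v, J v> > 0 for the indicator v of one cluster.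
Starting at distance s from the point, in the direction v, at the beginning of an
interval whose length depends on s, the solution leaves a ball whose radius does
not depend on s.
*)
Require Import Defs.
From mathcomp Require Import all_boot all_order all_algebra.
From mathcomp Require Import ring lra.
From mathcomp Require Import all_classical all_reals all_analysis.
From mathcomp Require Import measurable_realfun.
Set Implicit Arguments.
Unset Strict Implicit.
Unset Printing Implicit Defensive.
Import Order.TTheory GRing.Theory Num.Theory.
Import numFieldNormedType.Exports.
Local Open Scope classical_set_scope.
Local Open Scope ring_scope.

(** * Calculus and the circle *)

(** The differential equation holds only off the jump times, and all that is used of these is that
    the coupling is constant just after each time. Monotonicity arguments therefore go through
    [right_derive_nincr], which asks for derivatives only to the right of each time and lets the
    bound under proof be assumed on the way. Stability concerns every solution and works with the
    lift that a solution carries; instability has to produce a solution, which is what the Picard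
    iteration is for. The radius of instability is fixed before [iota] and the realization, so the
    escape estimate must be quantitative, with constants depending on the matrix only. The law of a
    chain speaks of finitely many times, a window of uncountably many. Dyadic grids, with
    probability bounds independent of the mesh, and right-continuity bridge the gap. *)

Section RightInduction.
Context {R : realType}.
Implicit Types (g : R -> R) (a b t : R).

Lemma at_rightP (P : R -> Prop) t :
  (\forall s \near t^'+, P s) -> exists2 e, 0 < e & forall s, t < s -> s < t + e -> P s.
Proof.
rewrite /at_right near_withinE => /nbhs_ballP[e e0 H]; exists e => // s ts st.
by apply: H => //; rewrite /ball /= ltr_distlC; apply/andP; split; lra.
Qed.

Lemma near_at_right (P : R -> Prop) t e : 0 < e ->
  (forall s, t < s -> s < t + e -> P s) -> \forall s \near t^'+, P s.
Proof.
move=> e0 H; rewrite /at_right near_withinE; apply/nbhs_ballP; exists e => //= s.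
by rewrite /ball /= ltr_distlC => /andP[_ ?] ?; apply: H.
Qed.

Lemma within_continuousP g a b : {within `[a, b], continuous g} ->
  forall t, a <= t <= b -> forall e, 0 < e ->
  exists2 d, 0 < d & forall s, a <= s <= b -> `|s - t| < d -> `|g s - g t| < e.
Proof.
move=> cg t tab e e0.
have /subspace_continuousP/(_ t) := cg.
rewrite /= in_itv /= => /(_ tab)/cvgrPdist_lt/(_ _ e0).
rewrite near_withinE => /nbhs_ballP[d d0 H].
exists d => // s sab sd; rewrite distrC; apply: (H s); last by rewrite /= in_itv.
by rewrite /ball /= distrC.
Qed.

(* Real induction on the set of times up to which [g] stays below [g a]: only
   right neighbourhoods are inspected, so left accumulation of exceptional
   points would be harmless. *)
Lemma right_derive_nincr g a b : a <= b -> {within `[a, b], continuous g} ->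
  (forall t, a <= t -> t < b -> g t <= g a ->
     \forall s \near t^'+, exists2 dg : R, is_derive (s : R) 1 g dg & dg <= 0) ->
  g b <= g a.
Proof.
move=> ab cg Hd.
pose E := [set t | a <= t <= b /\ forall s, a <= s <= t -> g s <= g a].
have Ea : E a.
  by split=> [|s /andP[s1 s2]]; rewrite ?lexx ?ab// (le_anti (introT andP (conj s2 s1))).
have ubE : ubound E b by move=> t [/andP[]].
have supE : has_sup E by split; [exists a | exists b].
pose t := sup E.
have at_ : a <= t by apply: ub_le_sup => //; exists b.
have tb : t <= b by apply: ge_sup => //; exists a.
have lt_t s : a <= s -> s < t -> g s <= g a.
  move=> as_ st; have [u Eu su] : exists2 u, E u & s < u.
    have [u Eu] := sup_adherent (eps := t - s) ltac:(lra) supE.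
    by rewrite subKr; exists u.
  by case: Eu => _; apply; rewrite as_ ltW.
have gt_ : g t <= g a.
  rewrite leNgt; apply/negP => lt.
  have [d d0 Hc] := within_continuousP cg (introT andP (conj at_ tb)) (e := g t - g a) ltac:(lra).
  have at' : a < t by rewrite lt_neqAle at_ andbT; apply/eqP => E'; move: lt; rewrite -E' ltxx.
  pose s := Num.max a (t - d / 2).
  have [s1 s2] : a <= s /\ t - d/2 <= s by rewrite /s; split; rewrite le_max lexx ?orbT.
  have s3 : s < t by rewrite /s gt_max at' /=; lra.
  have := Hc s ltac:(apply/andP; lra) ltac:(rewrite ltr_distl; apply/andP; lra).
  by rewrite ltr_distl => /andP[]; have := lt_t s s1 s3; lra.
have Et : E t.
  split=> [|s /andP[s1]]; first by rewrite at_.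
  by rewrite le_eqVlt => /orP[/eqP ->//|]; exact: lt_t.
move: (tb); rewrite le_eqVlt => /orP[/eqP <-//|tb'].
have [e e0 He] := at_rightP (Hd t at_ tb' gt_).
pose u := Num.min b (t + e / 2).
have tu : t < u by rewrite /u lt_min tb' /=; lra.
have ub : u <= b by rewrite /u ge_min lexx.
have ue : u < t + e by rewrite /u gt_min; apply/orP; right; lra.
have sub : {within `[t, u], continuous g}.
  apply: continuous_subspaceW cg => s; rewrite /= !in_itv /= => /andP[? ?].
  by apply/andP; lra.
suff Eu : E u by have := ub_le_sup (ex_intro _ b ubE) Eu; rewrite -/t; lra.
split=> [|s /andP[s1 s2]]; first by apply/andP; lra.
have [st|ts] := leP s t; first by case: Et => _; apply; rewrite s1.
apply: le_trans gt_.
have dg x : x \in `]t, u[ -> exists2 d : R, is_derive x 1 g d & d <= 0.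
  by rewrite in_itv /= => /andP[? ?]; apply: He => //; lra.
apply: (ler0_derive1_le_cc (a := t) (b := u)) => //.
- by move=> x /dg[d [] ].
- by move=> x /dg[d Hx d0]; rewrite derive1E (@derive_val _ _ _ _ _ _ _ Hx).
- by rewrite in_itv /= (ltW ts).
- by rewrite in_itv /= lexx ltW.
- exact: ltW.
Qed.

End RightInduction.

Section SineEstimates.
Context {R : realType}.
Implicit Types x z : R.

(** Two applications of the mean value theorem. This quadratic remainder serves both the dissipation
    and the escape estimates. *)
Lemma sin_sub_id_le z : `|sin z - z| <= z ^+ 2.
Proof.
have cos1 (x : R) : `|cos x - 1| <= `|x|.
  have H (y : R) : 0 <= y -> `|cos y - 1| <= y.
    move=> y0; have [c _] := @MVT_segment R cos (fun t => - sin t) 0 y y0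
      (fun x _ => is_derive_cos x) (continuous_subspaceT (@continuous_cos R)).
    rewrite cos0 subr0 => ->; rewrite normrM normrN (ger0_norm y0) ler_piMl//.
    by rewrite ler_norml sin_geN1 sin_le1.
  have [x0|x0] := leP 0 x; first by rewrite (ger0_norm x0) H.
  by rewrite (ltr0_norm x0) -cosN H// oppr_ge0 ltW.
have H (y : R) : 0 <= y -> `|sin y - y| <= y ^+ 2.
  move=> y0.
  have D x : x \in `]0, y[ -> is_derive x 1 (fun t => sin t - t) (cos x - 1).
    by move=> _; apply: is_deriveB.
  have C : {within `[0, y], continuous (fun t : R => sin t - t)}.
    apply: continuous_subspaceT => x; apply: (@continuousB _ R); last exact: cvg_id.
    exact: continuous_sin.
  have [c] := MVT_segment y0 D C.
  rewrite in_itv /= => /andP[c0 cy].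
  rewrite sin0 !subr0 => ->; rewrite normrM (ger0_norm y0) expr2 ler_wpM2r//.
  by apply: (le_trans (cos1 c)); rewrite ger0_norm.
have [z0|z0] := leP 0 z; first exact: H.
have := H (- z); rewrite sinN oppr_ge0 => /(_ (ltW z0)).
by rewrite -opprD normrN sqrrN.
Qed.

Lemma mul_sin_ge z : `|z| <= 1 / 2 -> z ^+ 2 / 2 <= z * sin z.
Proof.
move=> hz; have -> : z * sin z = z ^+ 2 + z * (sin z - z) by ring.
have : `|z * (sin z - z)| <= z ^+ 2 / 2.
  rewrite normrM mulrC; apply: (@le_trans _ _ (z ^+ 2 * (1/2))); last by lra.
  by rewrite ler_pM// sin_sub_id_le.
by rewrite ler_norml => /andP[]; lra.
Qed.

End SineEstimates.

(** * Representatives of angles and the quotient norm *)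

Section Circle.
Context {R : realType}.
Implicit Types (x y : R) (a b : circle R).

Lemma angleD x y : angle (x + y) = angle x + angle y.
Proof. by rewrite /angle; exact: raddfD. Qed.

Lemma angleB x y : angle (x - y) = angle x - angle y.
Proof. by rewrite /angle; exact: raddfB. Qed.

Lemma angle_repr a : exists x, a = angle x.
Proof. by exists (repr (a : Quotient.quot (@period_lattice R))); rewrite /angle reprK. Qed.

Lemma angle_eqP x y : angle x = angle y -> exists m : int, x = y + m%:~R * (pi *+ 2).
Proof.
move=> /eqP; rewrite /angle -Quotient.idealrBE unfold_in => /intrP[m ym]; exists m.
have pi2 : (pi *+ 2 : R) != 0 by rewrite mulrn_eq0 /= gt_eqF // pi_gt0.
by rewrite -ym mulfVK // addrC subrK.
Qed.

Lemma angle_period x (m : int) : angle (x + m%:~R * (pi *+ 2)) = angle x.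
Proof.
have pi2 : (pi *+ 2 : R) != 0 by rewrite mulrn_eq0 /= gt_eqF // pi_gt0.
apply/eqP; rewrite /angle -Quotient.idealrBE unfold_in; apply/intrP; exists m.
by rewrite addrC addKr mulfK.
Qed.

Lemma angle_small_repr a : exists2 x, a = angle x & `|x| <= pi.
Proof.
have [y ->] := angle_repr a.
have p0 := pi_gt0 R.
(* Removing m turns brings y into [-pi, pi[. *)
pose m := Num.floor ((y + pi) / (pi *+ 2)).
exists (y + (- m)%:~R * (pi *+ 2)); first by rewrite angle_period.
have /andP[] := Num.Theory.floor_itv ((y + pi) / (pi *+ 2)).
rewrite -/m.
rewrite ler_pdivlMr ?ltr_pdivrMr; [|lra|lra]; rewrite intrD rmorph1 rmorphN /=.
by move=> h1 h2; rewrite ler_norml; apply/andP; split; lra.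
Qed.

(** Any other representative is off by at least 2 pi, so its absolute value is at least 2 pi - pi =
    pi. *)
Lemma geo_angle x : `|x| <= pi -> geo (angle x) = `|x|.
Proof.
move=> xpi; have p0 := pi_gt0 R.
apply/le_anti/andP; split.
  by apply: ge_inf; [exists 0 => _ [y _ <-] | exists x].
apply: lb_le_inf; first by exists `|x|, x.
move=> _ [y /= /angle_eqP[m ->] <-].
have [->|m0] := eqVneq m 0; first by rewrite mul0r addr0.
have m1 : (1:R) <= `|m%:~R|.
  by rewrite -intr_norm ler1z; case: m m0 => [[|n]|n].
apply: (le_trans xpi); rewrite addrC.
apply: (le_trans _ (lerB_normD _ _)); rewrite normrM (@ger0_norm _ (pi *+ 2)); last by lra.
have : pi *+ 2 <= `|m%:~R| * (pi *+ 2) :> R by rewrite ler_peMl//; lra.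
lra.
Qed.

Lemma geo_ge0 a : 0 <= geo a.
Proof. by have [x -> xp] := angle_small_repr a; rewrite geo_angle. Qed.

Lemma geo_le_pi a : geo a <= pi.
Proof. by have [x -> xp] := angle_small_repr a; rewrite geo_angle. Qed.

Lemma geo_angle_le x : geo (angle x) <= `|x|.
Proof.
have [xp|xp] := leP `|x| pi; first by rewrite geo_angle.
exact: le_trans (geo_le_pi _) (ltW xp).
Qed.

Lemma geo_eq0 a : geo a = 0 -> a = 0.
Proof.
have [x -> xp] := angle_small_repr a; rewrite geo_angle// => /normr0P/eqP ->.
by rewrite /angle raddf0.
Qed.

Lemma geo_eq_pi a : geo a = pi -> a = angle pi.
Proof.
have [x -> xp] := angle_small_repr a; rewrite geo_angle// => xE.
have [x0|x0] := leP 0 x; first by rewrite -xE ger0_norm.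
rewrite ltr0_norm// in xE; rewrite -(angle_period x 1) -xE; congr angle; lra.
Qed.

Lemma circle_sin_angleB x y : circle_sin (angle x - angle y) = sin (x - y).
Proof. by rewrite -angleB circle_sinE. Qed.

End Circle.

Section MaxNorm.
Context {R : realType} {I : finType}.
Implicit Types th : I -> circle R.

Lemma geo_le_max_norm th i : geo (th i) <= max_norm th.
Proof. exact: (le_bigmax_cond 0 (fun i => geo (th i))). Qed.

Lemma max_norm_le th e : 0 <= e -> (forall i, geo (th i) <= e) -> max_norm th <= e.
Proof. by move=> e0 H; apply: bigmax_le. Qed.

End MaxNorm.

(** * Existence of solutions *)

Section Primitive.
Context {R : realType}.
Local Notation mu := (@lebesgue_measure R).
Variables (g : R -> R) (C t0 : R).
Hypotheses (mg : measurable_fun setT g) (gC : forall s, `|g s| <= C).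

Let F (t : R) : R := \int[mu]_(s in `[t0, t]) g s.

Lemma bounded_itv_integrable (i : interval R) (f : R -> R) c :
  (mu [set` i] < +oo)%E ->
  measurable_fun setT f -> (forall s, `|f s| <= c) -> mu.-integrable [set` i] (EFin \o f).
Proof.
move=> fin mf fc; apply: measurable_bounded_integrable => //.
  exact: measurable_funS mf.
exists c; split; rewrite ?num_real// => x cx y _.
exact: le_trans (fc y) (ltW cx).
Qed.

Let fin_itv b1 b2 (x y : R) : (mu [set` Interval (BSide b1 x) (BSide b2 y)] < +oo)%E.
Proof. by rewrite lebesgue_measure_itv /=; case: ifPn => // _; rewrite -EFinB ltry. Qed.

Lemma Rintegral_itv_le b1 b2 (x y : R) : x <= y ->
  `|\int[mu]_(s in [set` Interval (BSide b1 x) (BSide b2 y)]) g s| <= C * (y - x).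
Proof.
move=> xy; apply: le_trans.
  apply: le_normr_Rintegral => //; exact: bounded_itv_integrable gC.
apply: (@le_trans _ _ (\int[mu]_(s in [set` Interval (BSide b1 x) (BSide b2 y)]) C)).
  apply: le_Rintegral => //.
  - apply: (@bounded_itv_integrable _ (fun s => `|g s|) C) => //.
      exact: measurableT_comp.
    by move=> s /=; rewrite normr_id.
  - by apply: (@bounded_itv_integrable _ (cst C) `|C|) => // s.
rewrite Rintegral_cst// [X in fine X](@lebesgue_measure_itv R) /= lte_fin.
by case: ltP => [//|yx]; rewrite /= mulr0 mulr_ge0 ?subr_ge0// (le_trans _ (gC 0)).
Qed.

Lemma primitive_start t : t <= t0 -> F t = 0.
Proof.
rewrite /F le_eqVlt => /orP[/eqP ->|lt]; first by rewrite set_itv1 Rintegral_set1.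
by rewrite set_itv_ge ?Rintegral_set0// bnd_simp -ltNge.
Qed.

Lemma primitive_lipschitz s t : `|F s - F t| <= C * `|s - t|.
Proof.
wlog st : s t / t <= s => [H|].
  have [/H//|/ltW/H Hts] := leP t s.
  by rewrite distrC [`|s - t|]distrC.
have C0 : 0 <= C by rewrite (le_trans _ (gC 0)).
rewrite [in leRHS]ger0_norm ?subr_ge0//.
have [t0t|tt0] := leP t0 t.
  rewrite Rintegral_itvB ?bnd_simp//; last exact: bounded_itv_integrable gC.
  exact: Rintegral_itv_le.
rewrite (primitive_start (ltW tt0)) subr0.
have [st0|t0s] := leP s t0.
  by rewrite (primitive_start st0) normr0 mulr_ge0// subr_ge0.
by apply: (le_trans (Rintegral_itv_le _ _ (ltW t0s))); rewrite ler_wpM2l// lerB// ltW.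
Qed.

Lemma primitive_derive t : t0 < t -> {for t, continuous g} -> is_derive t 1 F (g t).
Proof.
move=> t0t ct.
have [] := @continuous_FTC1_closed R g t0 t (t + 1) ltac:(by rewrite ltrDl) _ t0t ct.
  exact: bounded_itv_integrable gC.
move=> dF dFE; split; first exact: dF.
by rewrite -derive1E.
Qed.

End Primitive.

Section LipschitzContinuous.
Context {R : realType}.

Lemma lipschitz_real_continuous (f : R -> R) C :
  (forall s t, `|f s - f t| <= C * `|s - t|) -> continuous f.
Proof.
move=> fC t; apply/cvgrPdist_le => e e0.
apply/nbhs_ballP; exists (e / (`|C| + 1)) => /=; first by rewrite divr_gt0// ltr_wpDl.
move=> s /=; rewrite /ball /= ltr_pdivlMr ?ltr_wpDl// => H.
apply: (le_trans (fC t s)); apply: le_trans (ltW H).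
by rewrite mulrC ler_wpM2l//; have := ler_norm C; lra.
Qed.

End LipschitzContinuous.

Section RightStep.
Context {R : realType}.

Lemma measurable_floor_comp (g : int -> R) :
  measurable_fun setT (fun t : R => g (Num.floor t)).
Proof.
move=> _ B mB; rewrite setTI.
have -> : (fun t : R => g (Num.floor t)) @^-1` B =
   \bigcup_(m : int) [set t : R | Num.floor t = m /\ B (g m)].
  by apply/seteqP; split=> t /=; [exists (Num.floor t) | move=> [m _ /= [<-]]].
apply: countable_bigcupT_measurable; first exact: countableP.
move=> m; have [Bm|nBm] := pselect (B (g m)); last first.
  by rewrite [X in measurable X](_ : _ = set0)//; apply/seteqP; split=> t //= [].
rewrite [X in measurable X](_ : _ = `[m%:~R, (m + 1)%:~R[%classic)//.
apply/seteqP; split=> t /=; rewrite in_itv /=.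
  by move=> [<- _]; exact: floor_itv.
by move=> H; split=> //; apply: floor_def.
Qed.

Lemma measurable_right_step (f : R -> R) :
  (forall t, \forall s \near t^'+, f s = f t) -> measurable_fun setT f.
Proof.
move=> fr.
(* The sampling point is the right end of the cell of mesh 1 / (n + 1) containing t. It lies
   strictly to the right of t, so [h n t] equals [f t] once the mesh is below the width on which f
   is constant. *)
pose h (n : nat) (t : R) := f ((Num.floor (t * n.+1%:R))%:~R / n.+1%:R + n.+1%:R^-1).
apply: (@measurable_fun_cvg _ _ _ setT h f) => [n|t _].
  have -> : h n = (fun t => f (t%:~R / n.+1%:R + n.+1%:R^-1)) \o (fun t : R => Num.floor t) \o
                  (fun t : R => t * n.+1%:R) by [].
  apply: measurableT_comp; last exact: mulrr_measurable.
  exact: measurable_floor_comp (fun m : int => f (m%:~R / n.+1%:R + n.+1%:R^-1)).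
have [e e0 He] := at_rightP (fr t).
apply: cvg_near_cst.
have [N _ HN] : \forall n \near \oo, n.+1%:R^-1 < e.
  exact: near_infty_natSinv_lt (PosNum e0).
exists N => // n /HN ne; rewrite /h; have n0 : (0 : R) < n.+1%:R by [].
have /andP[f1 f2] := floor_itv (t * n.+1%:R).
have -> : (Num.floor (t * n.+1%:R))%:~R / n.+1%:R + n.+1%:R^-1 =
  ((Num.floor (t * n.+1%:R) + 1)%:~R / n.+1%:R :> R) by rewrite intrD rmorph1 mulrDl mul1r.
apply: He; first by rewrite ltr_pdivlMr.
rewrite ltr_pdivrMr// mulrDl intrD rmorph1.
have : 1 < e * n.+1%:R by rewrite mulrC -ltr_pdivrMl// mulr1.
lra.
Qed.

End RightStep.

Lemma le_add_halves {R : realType} (x y a : R) :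
  (forall k, x <= y + a * 2^-1 ^+ k) -> x <= y.
Proof.
move=> H; apply/ler_addgt0Pr => e e0.
have a1 : 0 < `|a| + 1 by rewrite ltr_wpDl.
have [k _ /(_ k (leqnn k))] := near_infty_natSinv_expn_lt (PosNum (divr_gt0 e0 a1)).
rewrite /= div1r -exprVn ltr_pdivlMr// => Hk.
apply: (le_trans (H k)); rewrite lerD2l; apply: le_trans (ltW Hk).
rewrite mulrC ler_wpM2l// ?exprn_ge0//; have := ler_norm a; lra.
Qed.

(* Picard iteration; the weight [W] makes the integral operator contract by 1/2
   on all of [t0, +oo[ at once. *)
Section Picard.
Context {R : realType} {I : finType}.
Local Notation mu := (@lebesgue_measure R).
Variables (f : R -> (I -> R) -> I -> R) (C L t0 : R) (x0 : I -> R).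
Hypothesis L_gt0 : 0 < L.
Hypothesis fC : forall s x i, `|f s x i| <= C.
Hypothesis fL : forall s (x y : I -> R) (e : R), (forall j, `|x j - y j| <= e) ->
  forall i, `|f s x i - f s y i| <= L * e.
Hypothesis fm : forall u : R -> I -> R, (forall i, continuous (u ^~ i)) ->
  forall i, measurable_fun setT (fun s => f s (u s) i).
Hypothesis fc : forall u : R -> I -> R, (forall i, continuous (u ^~ i)) ->
  forall t, \forall s \near t^'+, forall i, {for s, continuous (fun s => f s (u s) i)}.

Let T (u : R -> I -> R) (t : R) (i : I) : R :=
  x0 i + \int[mu]_(s in `[t0, t]) f s (u s) i.

Let W (t : R) := expR (2 * L * (t - t0)).

Let T_start u t i : t <= t0 -> T u t i = x0 i.
Proof. by move=> tt0; rewrite /T primitive_start// addr0. Qed.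

Let T_lip (u : R -> I -> R) : (forall i, continuous (u ^~ i)) -> forall i s t,
  `|T u s i - T u t i| <= C * `|s - t|.
Proof.
move=> cu i s t; rewrite /T opprD addrACA subrr add0r.
by apply: primitive_lipschitz; [exact: fm | move=> r; exact: fC].
Qed.

Let T_cont (u : R -> I -> R) : (forall i, continuous (u ^~ i)) -> forall i, continuous (T u ^~ i).
Proof. by move=> cu i; apply: (@lipschitz_real_continuous _ _ C) => s t; exact: T_lip. Qed.

Let T_derive (u : R -> I -> R) : (forall i, continuous (u ^~ i)) -> forall i t, t0 < t ->
  {for t, continuous (fun s => f s (u s) i)} -> is_derive t 1 (T u ^~ i) (f t (u t) i).
Proof.
move=> cu i t tt0 ct.
rewrite -[X in is_derive _ _ _ X]add0r; apply: is_deriveD.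
apply: (@primitive_derive R (fun s => f s (u s) i) C) => //; exact: fm.
Qed.

Let W_derive (t : R) : is_derive t 1 W (2 * L * W t).
Proof.
have D : is_derive t 1 (fun t => 2 * L * (t - t0)) (2 * L).
  by apply: is_derive_eq; rewrite subr0 /GRing.scale /= mulr1.
have E := is_derive_expR (2 * L * (t - t0)).
rewrite [X in is_derive _ _ _ X]mulrC.
exact: (@is_derive1_comp R expR (fun t => 2 * L * (t - t0)) t _ _ E D).
Qed.

Let W_gt0 t : 0 < W t. Proof. exact: expR_gt0. Qed.

Let T_contract (u v : R -> I -> R) (c : R) :
  (forall i, continuous (u ^~ i)) -> (forall i, continuous (v ^~ i)) -> 0 <= c ->
  (forall t i, `|u t i - v t i| <= c * W t) -> forall t i, `|T u t i - T v t i| <= c / 2 * W t.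
Proof.
move=> cu cv c0 uv t i.
wlog suff H : u v cu cv uv / T u t i - T v t i <= c / 2 * W t.
  rewrite ler_norml (H u v)// andbT lerNl opprB (H v u)// => s j.
  by rewrite distrC.
have [tt0|t0t] := leP t t0.
  by rewrite !T_start// subrr mulr_ge0// ?divr_ge0// ltW.
(* Since W' = 2 L W, the derivative of h is at most L c W - (c / 2) 2 L W = 0: the contraction is
   obtained by differentiating. *)
pose h (s : R) : R := T u s i - T v s i - c / 2 * W s.
suff : h t <= 0 by rewrite subr_le0.
apply: (@le_trans _ _ (h t0)); last first.
  by rewrite /h !T_start// subrr sub0r oppr_le0 mulr_ge0// ?divr_ge0// ltW.
apply: right_derive_nincr; first exact: ltW.
  apply: continuous_subspaceT => s; apply: cvgB.
    by apply: cvgB; apply: T_cont.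
  apply: cvgM; first exact: cvg_cst.
  by apply: differentiable_continuous; apply/derivable1_diffP; case: (W_derive s).
move=> s t0s st _.
have [e1 e10 H1] := at_rightP (fc cu s); have [e2 e20 H2] := at_rightP (fc cv s).
apply: (@near_at_right _ _ _ (Num.min e1 e2)); first by rewrite lt_min e10.
move=> r sr re.
have r1 : r < s + e1 by apply: (lt_le_trans re); rewrite lerD2l ge_min lexx.
have r2 : r < s + e2 by apply: (lt_le_trans re); rewrite lerD2l ge_min lexx orbT.
have t0r : t0 < r by exact: le_lt_trans sr.
exists (f r (u r) i - f r (v r) i - c / 2 * (2 * L * W r)).
  have D1 : is_derive r 1 (T u ^~ i) (f r (u r) i) by apply: T_derive => //; exact: H1.
  have D2 : is_derive r 1 (T v ^~ i) (f r (v r) i) by apply: T_derive => //; exact: H2.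
  have D3 := W_derive r.
  by apply: is_derive_eq.
have := fL r (uv r) i; rewrite ler_norml => /andP[_]; lra.
Qed.

Let u_ (k : nat) : R -> I -> R := iter k T (fun=> x0).

Let u_cont k : forall i, continuous (u_ k ^~ i).
Proof.
by elim: k => [|k IH] i; [move=> t; exact: cst_continuous | exact: T_cont].
Qed.

Let C_ge0 (i : I) : 0 <= C. Proof. exact: le_trans (fC 0 x0 i). Qed.
(** With this value the first increment, at most C (t - t0), stays below c0 W(t), because 1 + z <=
    exp z. *)
Let c0 : R := `|C| / (2 * L).

Let c0_ge0 : 0 <= c0. Proof. by rewrite divr_ge0// mulr_ge0// ltW. Qed.

Let u_diff k : forall t i, `|u_ k.+1 t i - u_ k t i| <= c0 * 2^-1 ^+ k * W t.
Proof.
elim: k => [|k IH] t i; last first.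
  rewrite exprSr mulrA; apply: (T_contract (@u_cont k.+1) (@u_cont k)) => //.
  by rewrite mulr_ge0// exprn_ge0.
rewrite expr0 mulr1 /= -/(T _ _ _).
have [tt0|t0t] := leP t t0; first by rewrite T_start// subrr normr0 mulr_ge0 ?(ltW (W_gt0 _)).
have := @T_lip (fun=> x0) (fun i t => @cst_continuous _ _ _ _) i t t0.
rewrite (@T_start _ t0)//.
move/le_trans; apply; rewrite ger0_norm ?subr_ge0 ?(ltW t0t)//.
have := expR_ge1Dx (2 * L * (t - t0)); rewrite -/(W t) => HW.
apply: (@le_trans _ _ (c0 * (2 * L * (t - t0)))); last first.
  by rewrite ler_wpM2l//; lra.
rewrite /c0 ger0_norm ?(C_ge0 i)//.
by have -> : C / (2 * L) * (2 * L * (t - t0)) = C * (t - t0) by field; rewrite gt_eqF.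
Qed.

(** The limit of the iterates as a supremum of lower bounds: lowered by the tail of the geometric
    series they increase, raised by it they decrease, so the error bound [u_near] comes with the
    construction. *)
Let u (t : R) (i : I) : R := sup (range (fun k => u_ k t i - 2 * c0 * 2^-1 ^+ k * W t)).

Let u_near k t i : `|u t i - u_ k t i| <= 2 * c0 * 2^-1 ^+ k * W t.
Proof.
rewrite /u; clearbody u_ T W c0.
have lo k1 n : u_ k1 t i - 2 * c0 * 2^-1 ^+ k1 * W t <=
    u_ (n + k1)%N t i - 2 * c0 * 2^-1 ^+ (n + k1) * W t.
  elim: n => [//|n IH]; apply: (le_trans IH).
  have := u_diff (n + k1) t i; rewrite addSn ler_norml => /andP[+ _].
  rewrite exprS; move: (_ ^+ (n + k1)) => q; lra.
have hi k1 n : u_ (n + k1)%N t i + 2 * c0 * 2^-1 ^+ (n + k1) * W t <=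
    u_ k1 t i + 2 * c0 * 2^-1 ^+ k1 * W t.
  elim: n => [//|n IH]; apply: le_trans IH.
  have := u_diff (n + k1) t i; rewrite addSn ler_norml => /andP[_].
  rewrite exprS; move: (_ ^+ (n + k1)) => q; lra.
have pos k1 : 0 <= 2 * c0 * 2^-1 ^+ k1 * W t.
  by rewrite !mulr_ge0// ?exprn_ge0// ltW.
have ub k1 : ubound (range (fun k => u_ k t i - 2 * c0 * 2^-1 ^+ k * W t))
    (u_ k1 t i + 2 * c0 * 2^-1 ^+ k1 * W t).
  move=> _ [m _ <-]; have := lo m k1; have := hi k1 m.
  by rewrite [(k1 + m)%N]addnC; have := pos (m + k1)%N; lra.
rewrite ler_norml; apply/andP; split.
  rewrite lerBrDl; apply: ub_le_sup; last by exists k.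
  by exists (u_ 0 t i + 2 * c0 * 2^-1 ^+ 0 * W t).
by rewrite lerBlDl; apply: ge_sup => //; exists (u_ 0 t i - 2 * c0 * 2^-1 ^+ 0 * W t), 0%N.
Qed.

Let u_lip i s t : `|u s i - u t i| <= C * `|s - t|.
Proof.
apply: (@le_add_halves _ _ _ (2 * c0 * (W s + W t) + C * `|s - t|)) => k.
have H : `|u_ k s i - u_ k t i| <= C * `|s - t|.
  case: k => [|k]; first by rewrite /= subrr normr0 mulr_ge0// (C_ge0 i).
  exact: T_lip.
have := u_near k s i; have := u_near k t i; move: H.
have : 0 <= C * `|s - t| * 2^-1 ^+ k by rewrite !mulr_ge0// ?exprn_ge0// (C_ge0 i).
rewrite !ler_norml; move: (_ ^+ k) => q ? /andP[? ?] /andP[? ?] /andP[? ?].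
by apply/andP; split; lra.
Qed.

Let u_fix t i : u t i = T u t i.
Proof.
have cu j : continuous (u ^~ j) by apply: (@lipschitz_real_continuous _ _ C) => ? ?; exact: u_lip.
apply/eqP; rewrite -subr_eq0 -normr_le0.
apply: (@le_add_halves _ _ _ (4 * c0 * W t)) => k; rewrite add0r.
have H1 := u_near k.+1 t i.
have H2 : `|T u t i - u_ k.+1 t i| <= 2 * c0 * 2^-1 ^+ k / 2 * W t.
  have q0 : 0 <= 2 * c0 * 2^-1 ^+ k by rewrite mulr_ge0 ?exprn_ge0// mulr_ge0.
  exact: (T_contract cu (@u_cont k) q0 (fun s j => u_near k s j)).
rewrite exprS in H1.
have := W_gt0 t; move: H1 H2; clearbody c0 u_ W T.
have : 0 <= c0 * 2^-1 ^+ k * W t by rewrite !mulr_ge0// ?exprn_ge0// ltW.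
rewrite !ler_norml; move: (_ ^+ k) => q ? /andP[? ?] /andP[? ?] ?.
by apply/andP; split; lra.
Qed.

Lemma picard : exists u : R -> I -> R,
  [/\ forall i, u t0 i = x0 i, forall i, continuous (u ^~ i) &
      forall i t, t0 < t -> {for t, continuous (fun s => f s (u s) i)} ->
        is_derive t 1 (u ^~ i) (f t (u t) i)].
Proof.
have cu i : continuous (u ^~ i) by apply: (@lipschitz_real_continuous _ _ C) => ? ?; exact: u_lip.
exists u; split=> // [i|i t t0t ct]; first by rewrite u_fix T_start.
have -> : u ^~ i = T u ^~ i by apply/funext => s; rewrite -u_fix.
exact: T_derive.
Qed.

End Picard.

Section FiniteSums.
Context {R : realType} {I : finType}.

Lemma is_derive_fsum (h : I -> R -> R) (dh : I -> R) (t : R) :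
  (forall i, is_derive t 1 (h i) (dh i)) ->
  is_derive t 1 (fun s => \sum_i h i s) (\sum_i dh i).
Proof.
move=> H; have -> : (fun s => \sum_i h i s) = \sum_i h i.
  by apply/funext => s; rewrite fct_sumE.
by elim/big_ind2 : _ => // [|] *; [exact: is_derive_cst | exact: is_deriveD].
Qed.

Lemma cvg_fsum {T : Type} (F : set_system T) {FF : Filter F} (h : I -> T -> R) (l : I -> R) :
  (forall i, h i x @[x --> F] --> l i) -> \sum_i h i x @[x --> F] --> \sum_i l i.
Proof.
move=> H; apply: (@cvg_big R I +%R 0 (fun=> true) _ T) => //.
exact: add_continuous.
Qed.

Lemma within_continuous_fsum (D : set R) (h : I -> R -> R) :
  (forall i, {within D, continuous (h i)}) -> {within D, continuous (fun t => \sum_i h i t)}.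
Proof. by move=> H t; apply: cvg_fsum => i; exact: H. Qed.

(** Summation by parts: exchange i and j in the double sum and average the two expressions. It turns
    derivatives of quadratic quantities into sums over edges. *)
Lemma sum_antisym (g : I -> I -> R) (y : I -> R) : (forall i j, g i j = - g j i) ->
  \sum_i y i * \sum_j g i j = - (\sum_i \sum_j (y j - y i) * g i j) / 2.
Proof.
move=> gN.
have E1 : \sum_i y i * \sum_j g i j = \sum_i \sum_j y i * g i j.
  by apply: eq_bigr => i _; rewrite mulr_sumr.
have E2 : \sum_i \sum_j y j * g i j = - \sum_i \sum_j y i * g i j.
  rewrite exchange_big /= -sumrN; apply: eq_bigr => i _; rewrite -sumrN.
  by apply: eq_bigr => j _; rewrite gN mulrN.
have -> : \sum_i \sum_j (y j - y i) * g i j =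
    \sum_i \sum_j y j * g i j - \sum_i \sum_j y i * g i j.
  rewrite -sumrB; apply: eq_bigr => i _; rewrite -sumrB.
  by apply: eq_bigr => j _; rewrite mulrBl.
by rewrite E1 E2; lra.
Qed.

Lemma sum_antisym0 (g : I -> I -> R) : (forall i j, g i j = - g j i) ->
  \sum_i \sum_j g i j = 0.
Proof.
move=> gN; have := sum_antisym (fun=> 1) gN.
under eq_bigr do rewrite mul1r.
move=> ->; rewrite big1 ?oppr0 ?mul0r// => i _.
by rewrite big1// => j _; rewrite subrr mul0r.
Qed.

Lemma le_sum_term (h : I -> R) i : (forall i, 0 <= h i) -> h i <= \sum_i h i.
Proof. by move=> h0; rewrite (bigD1 i)//= lerDl sumr_ge0. Qed.

Lemma sum_cst (c : R) : \sum_(i : I) c = #|I|%:R * c.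
Proof. by rewrite sumr_const mulr_natl. Qed.

End FiniteSums.

(** * Real lifts of the Kuramoto flow *)

Section Lifts.
Context {R : realType} {I : finType}.
Implicit Types (a : I -> I -> R) (x y : I -> R).

Definition lift_field (K : R) a x i : R :=
  K / #|I|%:R * \sum_j a i j * sin (x j - x i).

Lemma kuramoto_field_angle K a x i :
  kuramoto_field K a (fun i => angle (x i)) i = lift_field K a x i.
Proof.
rewrite /kuramoto_field; congr (_ * _); apply: eq_bigr => j _.
by rewrite circle_sin_angleB.
Qed.

Lemma sin_lipschitz (u v : R) : `|sin u - sin v| <= `|u - v|.
Proof.
wlog uv : u v / v <= u => [H|].
  have [/H//|/ltW/H] := leP v u; by rewrite distrC [`|v - u|]distrC.
have [c _ ->] := MVT_segment uv (fun z _ => is_derive_sin z)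
  (continuous_subspaceT (@continuous_sin R)).
by rewrite normrM ler_piMl// ler_norml cos_geN1 cos_le1.
Qed.

Variables (K : R) (A : R -> I -> I -> R) (C : R).
Hypothesis AC : forall t i j, `|A t i j| <= C.
Hypothesis Astep : forall t, 0 <= t -> \forall s \near t^'+, forall i j, A s i j = A t i j.

Lemma lift_exists (t0 : R) (x0 : I -> R) : 0 <= t0 ->
  exists phi : I -> R -> R,
    [/\ forall i, phi i t0 = x0 i, forall i, continuous (phi i) &
        forall i t, t0 < t -> (\forall s \near t, forall j k, A s j k = A t j k) ->
          is_derive t 1 (phi i) (lift_field K (A t) (phi ^~ t) i)].
Proof.
move=> t00.
(* Freezing the coupling before t0 makes it right-constant on the whole line, as the Picard
   iteration requires, and changes nothing after t0. *)
pose B s := A (Num.max s t0).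
have Bstep t : \forall s \near t^'+, forall i j, B s i j = B t i j.
  have [tt0|t0t] := ltP t t0.
    apply: (@near_at_right _ _ _ (t0 - t)); first by rewrite subr_gt0.
    move=> s ts st0 i j; rewrite /B !max_r//; [exact: ltW|lra].
  have [e e0 H] := at_rightP (Astep (le_trans t00 t0t)).
  apply: (@near_at_right _ _ _ e) => // s ts se i j.
  by rewrite /B !max_l//; [exact: H | exact: le_trans (ltW ts)].
have Bnear t : \forall s \near t^'+, \forall r \near s, forall i j, B r i j = B s i j.
  have [e e0 H] := at_rightP (Bstep t).
  apply: (@near_at_right _ _ _ e) => // s ts se.
  have : s \in `]t, (t + e)[ by rewrite in_itv /= ts.
  move/near_in_itvoo; apply: filterS => r; rewrite in_itv /= => /andP[r1 r2] i j.
  by rewrite !H.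
pose f s x i := lift_field K (B s) x i.
pose D := `|K / #|I|%:R| * \sum_(j : I) `|C|.
have AC' t i j : `|A t i j| <= `|C| by rewrite (le_trans (AC t i j))// ler_norm.
have D0 : 0 <= D by rewrite mulr_ge0// sumr_ge0.
have fcont (u : R -> I -> R) : (forall i, continuous (u ^~ i)) ->
    forall s, (\forall r \near s, forall i j, B r i j = B s i j) ->
    forall i, {for s, continuous (fun r => f r (u r) i)}.
  move=> cu s Hs i; rewrite /f /lift_field.
  apply: cvgM; first exact: cvg_cst.
  apply: cvg_fsum => j; apply: cvgM.
    by apply: (@cvg_near_cst _ _ (B s i j)); apply: filterS Hs => r ->.
  apply: (@continuous_comp _ _ _ (fun r => u r j - u r i) sin); last exact: continuous_sin.
  by apply: cvgB; apply: cu.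
have fbound s x i : `|f s x i| <= D.
  rewrite normrM ler_wpM2l//; apply: (le_trans (ler_norm_sum _ _ _)).
  apply: ler_sum => j _; rewrite normrM -[leRHS]mulr1 ler_pM ?AC'//.
  by rewrite ler_norml sin_geN1 sin_le1.
have D1 : 0 < 2 * D + 1 by rewrite ltr_wpDl// mulr_ge0.
have flip s (x y : I -> R) (e : R) : (forall j, `|x j - y j| <= e) ->
    forall i, `|f s x i - f s y i| <= (2 * D + 1) * e.
  move=> H i; have e0 : 0 <= e by apply: le_trans (H i).
  apply: (@le_trans _ _ (D * (2 * e))); last by lra.
  rewrite /f /lift_field -mulrBr normrM /D -mulrA ler_wpM2l//.
  rewrite -sumrB mulr_suml; apply: (le_trans (ler_norm_sum _ _ _)).
  apply: ler_sum => j _; rewrite -mulrBr normrM ler_pM ?AC'//.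
  apply: (le_trans (sin_lipschitz _ _)).
  have -> : x j - x i - (y j - y i) = (x j - y j) - (x i - y i) by ring.
  by apply: (le_trans (ler_normB _ _)); have := H i; have := H j; lra.
have fmeas (u : R -> I -> R) : (forall i, continuous (u ^~ i)) ->
    forall i, measurable_fun setT (fun s => f s (u s) i).
  move=> cu i; apply: measurable_funM; first exact: measurable_cst.
  apply: measurable_sum => j; apply: measurable_funM.
    apply: measurable_right_step => t; apply: filterS (Bstep t) => s; exact.
  apply: continuous_measurable_fun => s.
  apply: (@continuous_comp _ _ _ (fun r => u r j - u r i) sin); last exact: continuous_sin.
  by apply: cvgB; apply: cu.
have fnear (u : R -> I -> R) : (forall i, continuous (u ^~ i)) ->
    forall t, \forall s \near t^'+, forall i, {for s, continuous (fun s => f s (u s) i)}.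
  by move=> cu t; apply: filterS (Bnear t) => s Hs i; exact: fcont.
have [u [u0 cu du]] := @picard R I f D (2 * D + 1) t0 x0 D1 fbound flip fmeas fnear.
exists (fun i t => u t i); split=> // i t t0t Ht.
have -> : lift_field K (A t) (u t) i = f t (u t) i.
  by rewrite /f /B max_l// ltW.
apply: du => //; apply: fcont => //.
have := Ht; have : \forall s \near t, t0 < s by exact: lt_nbhsr.
apply: filterS2 => s t0s Hs j k.
by rewrite /B !max_l ?Hs ?(ltW t0t) ?(ltW t0s).
Qed.

End Lifts.

(** * Synchronization and instability for a driven coupling *)

Section ConnectedSpread.
Context {R : realType} {I : finType}.

(** Telescoping along a simple path, which has fewer than [#|I|] edges. With [eta = 0] it says that
    a function constant across edges is constant. *)
Lemma connected_spread (e : rel I) (y : I -> R) (eta : R) : 0 <= eta ->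
  (forall i j, connect e i j) -> (forall i j, e i j -> `|y j - y i| <= eta) ->
  forall i j, `|y j - y i| <= #|I|%:R * eta.
Proof.
move=> eta0 conn He i j.
have Hp p k : path e k p -> `|y (last k p) - y k| <= (size p)%:R * eta.
  elim: p k => [|l p IH] k /=; first by rewrite subrr normr0 mul0r.
  move=> /andP[/He kl /IH H].
  have -> : y (last l p) - y k = (y (last l p) - y l) + (y l - y k) by ring.
  by apply: (le_trans (ler_normD _ _)); rewrite -natr1 mulrDl mul1r lerD.
have /connectP[p ep ->] := conn i j.
case/shortenP: ep => q eq uq _.
apply: (le_trans (Hp _ _ eq)); rewrite ler_wpM2r// ler_nat.
have := max_card (mem (i :: q)); rewrite (card_uniqP uq) /=; exact: ltnW.
Qed.

(** Finiteness turns positivity into a uniform bound, for edge weights and for transition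
    probabilities alike. *)
Lemma positive_lower_bound {J : finType} (h : J -> R) :
  exists2 c, 0 < c & forall j, 0 < h j -> c <= h j.
Proof.
exists (\big[Num.min/1]_(j | 0 < h j) h j).
  by apply: lt_bigmin.
by move=> j hj; apply: bigmin_le_cond.
Qed.

End ConnectedSpread.

(** * Decay of the variance *)

Section Stability.
Context {R : realType} {I : finType}.
Variables (K : R) (A : R -> I -> I -> R) (M : I -> I -> R).
Hypothesis K_gt0 : 0 < K.
Hypothesis A_step : forall t, 0 <= t -> \forall s \near t^'+, forall i j, A s i j = A t i j.
Hypothesis A_sym : forall t i j, A t i j = A t j i.
Hypothesis A_ge0 : forall t i j, 0 <= A t i j.
Hypothesis M_conn : forall i j, connect (fun i j => 0 < M i j) i j.
Hypothesis windows : forall T0 L : R, exists t,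
  [/\ 0 <= t, T0 <= t & forall s, t <= s -> s < t + L -> forall i j, A s i j = M i j].

Variables (t0 : R) (phi : I -> R -> R).
Hypothesis t0_ge0 : 0 <= t0.
Hypothesis phi_cont : forall i, {within `[t0, +oo[, continuous (phi i)}.
Hypothesis phi_derive : forall i t, t0 < t ->
  (\forall s \near t, forall j k, A s j k = A t j k) ->
  is_derive t 1 (phi i) (lift_field K (A t) (phi ^~ t) i).

Let n : R := #|I|%:R.
Let m : R := (\sum_i phi i t0) / n.
Let y i t := phi i t - m.
Let p t := \sum_i y i t ^+ 2.

Let derive_near t : t0 <= t -> \forall s \near t^'+, forall i,
  is_derive (s : R) 1 (phi i) (lift_field K (A s) (phi ^~ s) i).
Proof.
move=> t0t; have [e e0 H] := at_rightP (A_step (le_trans t0_ge0 t0t)).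
apply: (@near_at_right _ _ _ e) => // s ts se i.
apply: phi_derive; first exact: le_lt_trans ts.
have : s \in `]t, (t + e)[ by rewrite in_itv /= ts.
move/near_in_itvoo; apply: filterS => r; rewrite in_itv /= => /andP[r1 r2] j k.
by rewrite !H.
Qed.

Let cont_seg a b i : t0 <= a -> {within `[a, b], continuous (phi i)}.
Proof.
move=> t0a; apply: continuous_subspaceW (@phi_cont i) => s /=.
by rewrite !in_itv /= andbT => /andP[/(le_trans t0a)].
Qed.

Let field_sum0 a (x : I -> R) : (forall i j, a i j = a j i) ->
  \sum_i lift_field K a x i = 0.
Proof.
move=> asym; rewrite /lift_field -mulr_sumr.
rewrite (sum_antisym0 (g := fun i j => a i j * sin (x j - x i))) ?mulr0// => i j.
by rewrite asym -mulrN -sinN opprB.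
Qed.

Let sum_const t : t0 <= t -> \sum_i phi i t = \sum_i phi i t0.
Proof.
move=> t0t.
have D s : t0 <= s -> \forall r \near s^'+, is_derive (r : R) 1 (fun r : R => \sum_i phi i r) 0.
  move=> t0s; apply: filterS (derive_near t0s) => r Hr.
  by have := is_derive_fsum Hr; rewrite field_sum0.
have cS : {within `[t0, t], continuous (fun r => \sum_i phi i r)}.
  by apply: within_continuous_fsum => i; exact: cont_seg.
apply/le_anti/andP; split.
  apply: (right_derive_nincr t0t cS) => s t0s _ _.
  by apply: filterS (D _ t0s) => r Hr; exists 0.
rewrite -lerN2; apply: (@right_derive_nincr _ (fun r => - \sum_i phi i r)) => //.
  by move=> x; apply: cvgN; exact: cS.
move=> s t0s _ _; apply: filterS (D _ t0s) => r Hr.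
by exists 0 => //; apply: is_derive_eq; rewrite oppr0.
Qed.

Let y_sum0 t : t0 <= t -> \sum_i y i t = 0.
Proof.
move=> t0t; rewrite /y sumrB sum_const// sumr_const -mulr_natl -/n /m.
have [n0|n0] := eqVneq n 0; last by rewrite mulrCA divff// mulr1 subrr.
rewrite n0 mul0r subr0 big_pred0// => i.
by have := fintype0 i; move: n0; rewrite /n => /eqP; rewrite pnatr_eq0 => /eqP n0 /(_ n0).
Qed.

Let flow t := \sum_i \sum_j (y j t - y i t) * (A t i j * sin (y j t - y i t)).

Let p_derive (t : R) : (forall i, is_derive t 1 (phi i) (lift_field K (A t) (phi ^~ t) i)) ->
  is_derive t 1 p (- (K / n) * flow t).
Proof.
move=> H.
have -> : - (K / n) * flow t = \sum_i 2 * y i t * lift_field K (A t) (phi ^~ t) i.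
  rewrite /lift_field -/n.
  have -> : \sum_i 2 * y i t * (K / n * \sum_j A t i j * sin (phi j t - phi i t)) =
     2 * (K / n) * \sum_i y i t * \sum_j A t i j * sin (y j t - y i t).
    rewrite mulr_sumr; apply: eq_bigr => i _.
    have -> : \sum_j A t i j * sin (phi j t - phi i t) =
        \sum_j A t i j * sin (y j t - y i t).
      by apply: eq_bigr => j _; rewrite /y opprB addrA subrK.
    by ring.
  rewrite sum_antisym -/(flow t); first by move: (flow t) (K / n) => u v; lra.
  by move=> i j; rewrite A_sym -mulrN -sinN (opprB (y i t)).
apply: is_derive_fsum => i; have Hi := H i.
by apply: is_derive_eq; rewrite subr0 /GRing.scale /=; ring.
Qed.

(** Origin of the threshold 1 / 16: a squared difference is at most 4 p < 1 / 4, and up to 1 / 2 the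
    product [z * sin z] is at least [z ^+ 2 / 2]. *)
Let diff_small t : p t < 1 / 16 -> forall i j, `|y j t - y i t| <= 1 / 2.
Proof.
move=> pt i j.
have H k : y k t ^+ 2 <= p t.
  by apply: (le_sum_term (h := fun i => y i t ^+ 2)) => l; exact: sqr_ge0.
rewrite -ler_sqr ?nnegrE// real_normK ?num_real//.
have := H i; have := H j; have := sqr_ge0 (y i t + y j t); lra.
Qed.

Let term_ge0 t : p t < 1 / 16 -> forall i j,
  0 <= (y j t - y i t) * (A t i j * sin (y j t - y i t)).
Proof.
move=> pt i j; rewrite mulrCA mulr_ge0//.
apply: le_trans (mul_sin_ge (diff_small pt i j)).
by rewrite divr_ge0// sqr_ge0.
Qed.

Let Kn_ge0 : 0 <= K / n. Proof. by rewrite divr_ge0// ltW. Qed.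

Let p_cont a b : t0 <= a -> {within `[a, b], continuous p}.
Proof.
move=> t0a; apply: within_continuous_fsum => i s.
have c : (y i : subspace `[a, b] -> R) x @[x --> s] --> y i s.
  by apply: cvgB; [exact: cont_seg | exact: cvg_cst].
by apply: cvgM.
Qed.

(** A bootstrap: dissipation is known only while p < 1 / 16, and the bound [p t <= p a] granted by
    [right_derive_nincr], with continuity, supplies this just after t. *)
Let p_nincr a b : t0 <= a -> a <= b -> p a < 1 / 16 -> p b <= p a.
Proof.
move=> t0a ab pa; apply: right_derive_nincr => //; first exact: p_cont.
move=> t at_ tb pt; have t0t : t0 <= t by exact: le_trans at_.
have small : \forall s \near t^'+, p s < 1 / 16.
  have [d d0 H] := within_continuousP (@p_cont a b t0a)
    (introT andP (conj at_ (ltW tb))) (e := 1 / 16 - p t) ltac:(lra).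
  apply: (@near_at_right _ _ _ (Num.min d (b - t))).
    by rewrite lt_min d0 subr_gt0.
  move=> s ts sm.
  have s1 : s < t + d by apply: (lt_le_trans sm); rewrite lerD2l ge_min lexx.
  have s2 : s < b.
    by rewrite -[b](subrK t) addrC; apply: (lt_le_trans sm); rewrite lerD2l ge_min lexx orbT.
  have := H s ltac:(apply/andP; lra) ltac:(rewrite ltr_distl; apply/andP; lra).
  by rewrite ltr_distl => /andP[_]; lra.
apply: filterS2 (derive_near t0t) small => s Hs ps.
exists (- (K / n) * flow s); first exact: p_derive.
rewrite mulNr oppr_le0 mulr_ge0// sumr_ge0// => i _; rewrite sumr_ge0// => j _.
exact: term_ge0.
Qed.

Lemma lifts_synchronize : \sum_i phi i t0 ^+ 2 < 1 / 16 ->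
  exists c : R, forall e, 0 < e ->
    exists T, forall t, T <= t -> t0 <= t -> forall i, `|phi i t - c| <= e.
Proof.
move=> init; exists m => e e0.
have [i0 _|no] := pickP I; last by exists t0 => t _ _ i; have := no i.
have n1 : 1 <= n by rewrite /n ler1n; apply/card_gt0P; exists i0.
have n0 : 0 < n by lra.
(* The sum of squares about the mean is at most the sum of squares about 0. *)
have p0 : p t0 < 1 / 16.
  apply: le_lt_trans init.
  have -> : p t0 = \sum_i phi i t0 ^+ 2 - n * m ^+ 2.
    have E : \sum_i phi i t0 = n * m by rewrite /m mulrC divfK// gt_eqF.
    have -> : p t0 = \sum_i (phi i t0 ^+ 2 - (2 * m) * phi i t0 + m ^+ 2).
      by apply: eq_bigr => i _; rewrite /y; ring.
    rewrite big_split sumrB /= -mulr_sumr E sum_cst -/n; ring.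
  by rewrite lerBlDr lerDl mulr_ge0// ?sqr_ge0// ltW.
have p_lt s : t0 <= s -> p s < 1 / 16.
  by move=> t0s; apply: le_lt_trans (p_nincr (lexx _) t0s p0) p0.
suff [s t0s ps] : exists2 s, t0 <= s & p s <= e ^+ 2.
  exists s => t st t0t i.
  have ps1 : p s < 1 / 16 by exact: p_lt.
  rewrite -ler_sqr ?nnegrE ?(ltW e0)// real_normK ?num_real//.
  apply: le_trans ps; apply: le_trans (p_nincr t0s st ps1).
  by apply: (le_sum_term (h := fun i => y i t ^+ 2)) => l; exact: sqr_ge0.
have [mm mm0 Hmm] := positive_lower_bound (fun ij : I * I => M ij.1 ij.2).
(* If every edge of M had a gap at most eta, connectedness and the zero mean would bound each |y_i|
   by n eta, hence p by n (n eta)^2 = e^2 / (4 n). So p > e^2 forces an edge with a gap above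
   eta. *)
pose eta := e / (2 * n ^+ 2).
have eta0 : 0 < eta by rewrite divr_gt0// mulr_gt0// exprn_gt0.
have edge t : t0 <= t -> e ^+ 2 < p t -> exists i j, 0 < M i j /\ eta < `|y j t - y i t|.
  move=> t0t; apply: contraPP => /forallNP N; apply/negP; rewrite -leNgt.
  have sp : forall i j, `|y j t - y i t| <= n * eta.
    apply: connected_spread M_conn _; first exact: ltW.
    move=> i j Mij; rewrite leNgt; apply/negP => lt.
    by have /forallNP/(_ j) := N i; apply.
  have yi i : `|y i t| <= n * eta.
    have : n * y i t = \sum_j (y i t - y j t) by rewrite sumrB y_sum0// subr0 sum_cst.
    move=> /(congr1 Num.norm); rewrite normrM (ger0_norm (ltW n0)) => E.
    rewrite -(ler_pM2l n0) E; apply: (le_trans (ler_norm_sum _ _ _)).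
    have -> : n * (n * eta) = \sum_(j : I) n * eta by rewrite sum_cst.
    by apply: ler_sum => j _; exact: sp.
  apply: (@le_trans _ _ (\sum_(i : I) (n * eta) ^+ 2)).
    apply: ler_sum => i _; rewrite -[y i t ^+ 2]real_normK ?num_real//.
    by rewrite ler_sqr ?nnegrE// mulr_ge0// ltW.
  rewrite sum_cst -/n.
  have -> : n * (n * eta) ^+ 2 = e ^+ 2 * (4 * n)^-1.
    by rewrite /eta; field; rewrite gt_eqF.
  rewrite ler_piMr ?sqr_ge0// invf_le1 ?mulr_gt0//.
  by apply: (le_trans n1); rewrite ler_peMl ?ler1n// ltW.
(* The dissipation guaranteed by that single edge. Over a window of length 1 / lam the variance
   would drop by 1, although it is nonnegative and below 1 / 16. *)
pose lam := K / n * (mm * (eta ^+ 2 / 2)).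
have lam0 : 0 < lam.
  by rewrite mulr_gt0 ?divr_gt0// mulr_gt0// divr_gt0// exprn_gt0.
have [t [_ t0t Ht]] := windows t0 (1 / lam).
have L0 : 0 < 1 / lam by rewrite divr_gt0.
apply/not_exists2P => N.
have big s : t0 <= s -> e ^+ 2 < p s by move=> t0s; rewrite ltNge; apply/negP; case: (N s).
have pt : p t < 1 / 16 by exact: p_lt.
suff : p (t + 1 / lam) + lam * (t + 1 / lam) <= p t + lam * t.
  have -> : lam * (t + 1 / lam) = lam * t + 1 by field; rewrite gt_eqF.
  have : 0 <= p (t + 1 / lam) by apply: sumr_ge0 => i _; exact: sqr_ge0.
  lra.
apply: (@right_derive_nincr _ (fun s => p s + lam * s)); first by rewrite lerDl ltW.
  move=> s; apply: cvgD; first exact: p_cont.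
  by apply: cvgM; [exact: cvg_cst | apply: continuous_subspaceT => z; exact: cvg_id].
move=> s ts sL _; have t0s : t0 <= s by exact: le_trans ts.
have Hn : \forall r \near s^'+, s < r /\ r < t + 1 / lam.
  apply: (@near_at_right _ _ _ (t + 1 / lam - s)); first by rewrite subr_gt0.
  by move=> r sr; rewrite addrC subrK.
apply: filterS2 (derive_near t0s) Hn => r Hr [sr rL].
have D := p_derive Hr.
exists (- (K / n) * flow r + lam).
  by apply: is_derive_eq; rewrite /GRing.scale /= mulr1.
have t0r : t0 <= r by apply: le_trans t0s (ltW sr).
have pr : p r < 1 / 16 by exact: p_lt.
have [i [j [Mij yij]]] := edge r t0r (big r t0r).
rewrite mulNr addrC subr_le0 /lam ler_wpM2l//.
apply: (@le_trans _ _ ((y j r - y i r) * (A r i j * sin (y j r - y i r)))).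
  rewrite [leRHS]mulrCA Ht//; last exact: le_trans ts (ltW sr).
  apply: ler_pM; [exact: ltW| |exact: (Hmm (i, j))|].
    by rewrite divr_ge0// sqr_ge0.
  apply: le_trans (mul_sin_ge (diff_small pr i j)).
  rewrite ler_wpM2r// -[_ ^+ 2 in leRHS]real_normK ?num_real//.
  by rewrite ler_sqr ?nnegrE// ltW.
apply: (@le_trans _ _ (\sum_k (y k r - y i r) * (A r i k * sin (y k r - y i r)))).
  apply: (le_sum_term (h := fun k => (y k r - y i r) * (A r i k * sin (y k r - y i r)))).
  by move=> k; exact: term_ge0.
apply: (le_sum_term (h := fun i => \sum_k (y k r - y i r) * (A r i k * sin (y k r - y i r)))).
by move=> k; apply: sumr_ge0 => l _; exact: term_ge0.
Qed.

End Stability.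

(* Quantitative Chetaev argument for [x' = J x + r(x)] with [J] symmetric and
   [|r| = O(|x|^2)].  With [p = |x|^2] and [q = <x, J x>], the Rayleigh quotient
   [q / p] of the linear flow is nondecreasing; the corrected quantity
   [q + k p^2 - a p] stays positive along the nonlinear flow while [p] is small,
   which forces [p' >= a p]. *)
Section Escape.
Context {R : realType} {I : finType}.
Variable B : I -> I -> R.
Hypothesis B_sym : forall i j, B i j = B j i.
Implicit Types x y z v : I -> R.

Let F x i := \sum_j B i j * sin (x j - x i).
Let J x i := \sum_j B i j * (x j - x i).
Let p x := \sum_i x i ^+ 2.
Let q x := \sum_i x i * J x i.
Let n : R := #|I|%:R.

Let J_sym x z : \sum_i x i * J z i = \sum_i z i * J x i.
Proof.
rewrite /J (sum_antisym (g := fun i j => B i j * (z j - z i))); last first.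
  by move=> i j; rewrite B_sym -mulrN opprB.
rewrite (sum_antisym (g := fun i j => B i j * (x j - x i))); last first.
  by move=> i j; rewrite B_sym -mulrN opprB.
by congr (- _ / 2); apply: eq_bigr => i _; apply: eq_bigr => j _; ring.
Qed.

Let n_ge0 : 0 <= n. Proof. by []. Qed.

Let p_ge0 x : 0 <= p x. Proof. by apply: sumr_ge0 => i _; exact: sqr_ge0. Qed.

Let sqr_le_p x i : x i ^+ 2 <= p x.
Proof. by apply: (le_sum_term (h := fun i => x i ^+ 2)) => j; exact: sqr_ge0. Qed.

(** The 4 comes from (x_j - x_i)^2 <= 4 p; each row of B is bounded by the total sum. *)
Let c := 4 * \sum_i \sum_j `|B i j|.

Let c_ge0 : 0 <= c.
Proof. by rewrite mulr_ge0// sumr_ge0// => i _; rewrite sumr_ge0. Qed.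

Let r_le x i : `|F x i - J x i| <= c * p x.
Proof.
rewrite /F /J -sumrB; apply: (le_trans (ler_norm_sum _ _ _)).
apply: (@le_trans _ _ (\sum_j `|B i j| * (4 * p x))).
  apply: ler_sum => j _; rewrite -mulrBr normrM ler_wpM2l//.
  apply: (le_trans (sin_sub_id_le _)).
  have := sqr_le_p x i; have := sqr_le_p x j; have := sqr_ge0 (x i + x j); lra.
rewrite -mulr_suml mulrA [_ * 4]mulrC -/(p x) ler_wpM2r// ler_wpM2l//.
by apply: (le_sum_term (h := fun i => \sum_j `|B i j|)) => k; rewrite sumr_ge0.
Qed.

Variables (a : R).
Hypothesis a_gt0 : 0 < a.

(** Chosen so that n (c p)^2 = 2 a k p^2: the growth of k p^2 then absorbs the error that the
    nonlinear remainder causes in the derivative of q - a p. *)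
Let k := n * c ^+ 2 / (2 * a).
(** The term 4 (k + n c) limits the cost of the nonlinear corrections in [growth] to a p / 2; the
    other terms ensure eta <= 1. *)
Let eta := a / (4 * (k + n * c) + 4 * a + 4).

Let k_ge0 : 0 <= k. Proof. 
apply: divr_ge0; last by rewrite mulr_ge0// ltW.
by apply: mulr_ge0 => //; exact: sqr_ge0.
Qed.

Let den_gt0 : 0 < 4 * (k + n * c) + 4 * a + 4.
Proof. by have := mulr_ge0 n_ge0 c_ge0; have := k_ge0; have := a_gt0; lra. Qed.

Let eta_gt0 : 0 < eta. Proof. by rewrite divr_gt0. Qed.

Let eta_le1 : eta <= 1.
Proof.
rewrite ler_pdivrMr// mul1r; have := mulr_ge0 n_ge0 c_ge0; have := k_ge0.
by have := a_gt0; lra.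
Qed.

Let eta_bound : 4 * eta * (k + n * c) <= a.
Proof.
have E : eta * (4 * (k + n * c) + 4 * a + 4) = a by rewrite /eta divfK// gt_eqF.
have ea : 0 <= eta * a by rewrite mulr_ge0// ltW.
by move: E ea eta_gt0; clearbody eta; lra.
Qed.

Let Q x := q x + k * p x ^+ 2 - a * p x.

(** The right-hand side is p' along the flow. From Q >= 0, q is at least a p - k p^2, so p' is at
    least 2 a p minus corrections of at most 2 eta (k + n c) p <= a p / 2. *)
Let growth x : p x <= eta ^+ 2 -> 0 <= Q x -> 3 / 2 * a * p x <= 2 * \sum_i x i * F x i.
Proof.
move=> px Qx.
have E : \sum_i x i * F x i = q x + \sum_i x i * (F x i - J x i).
  by rewrite -big_split /=; apply: eq_bigr => i _; ring.
have xle i : `|x i| <= eta.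
  rewrite -ler_sqr ?nnegrE ?(ltW eta_gt0)// real_normK ?num_real//.
  exact: le_trans (sqr_le_p x i) px.
have : `|\sum_i x i * (F x i - J x i)| <= n * (eta * (c * p x)).
  apply: (le_trans (ler_norm_sum _ _ _)); rewrite -sum_cst.
  by apply: ler_sum => i _; rewrite normrM ler_pM// r_le.
rewrite ler_norml => /andP[H _].
have H1 : k * p x ^+ 2 <= k * eta * p x.
  rewrite expr2 mulrA ler_wpM2r ?p_ge0// ler_wpM2l// (le_trans px)//.
  by rewrite expr2 ler_piMr// ltW.
have H2 : 4 * eta * (k + n * c) * p x <= a * p x by rewrite ler_wpM2r ?p_ge0.
have : a * p x - k * p x ^+ 2 <= q x by move: Qx; rewrite /Q; lra.
rewrite E; move: H H1 H2; move: (\sum_i _) (q x) (p x ^+ 2) (p x) => S Z P2 P; lra.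
Qed.

(** The right-hand side is Q' along the flow, and the proof gives Q' >= 2 a Q. With F = J + r,
    completing the square yields 2 F (J - a x) >= 2 a x (J - a x) - r^2 / 2; the resulting loss a k
    p^2 is outweighed by 2 k p p' >= 3 a k p^2. *)
Let Q_growth x : p x <= eta ^+ 2 -> 0 <= Q x ->
  0 <= 2 * (\sum_i F x i * J x i) + (2 * k * p x - a) * (2 * \sum_i x i * F x i).
Proof.
move=> px Qx; have G := growth px Qx.
have H : 2 * a * (q x - a * p x) - n * (c * p x) ^+ 2 / 2 <=
    2 * (\sum_i F x i * J x i) - 2 * a * \sum_i x i * F x i.
  have -> : 2 * (\sum_i F x i * J x i) - 2 * a * (\sum_i x i * F x i) =
      \sum_i 2 * F x i * (J x i - a * x i).
    by rewrite !mulr_sumr -sumrB; apply: eq_bigr => i _; ring.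
  have -> : 2 * a * (q x - a * p x) - n * (c * p x) ^+ 2 / 2 =
      \sum_i (2 * a * (x i * J x i - a * x i ^+ 2) - (c * p x) ^+ 2 / 2).
    rewrite sumrB sum_cst -mulr_sumr sumrB -mulr_sumr -/(q x) -/(p x) -/n; ring.
  apply: ler_sum => i _.
  have : (F x i - J x i) ^+ 2 <= (c * p x) ^+ 2.
    by rewrite -real_normK ?num_real// ler_sqr ?nnegrE ?r_le// mulr_ge0 ?p_ge0.
  have := sqr_ge0 (2 * (J x i - a * x i) + (F x i - J x i)).
  move: (F x i) (J x i) (x i) (c * p x) => f j z w; lra.
have kE : k * (2 * a) = n * c ^+ 2 by rewrite /k divfK// gt_eqF// mulr_gt0.
have H3 : n * (c * p x) ^+ 2 = 2 * a * (k * p x ^+ 2).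
  transitivity (n * c ^+ 2 * p x ^+ 2); first by ring.
  by rewrite -kE; ring.
have H4 : 2 * k * p x * (3 / 2 * a * p x) <= 2 * k * p x * (2 * \sum_i x i * F x i).
  by rewrite ler_wpM2l// mulr_ge0 ?p_ge0// mulr_ge0.
have H5 : 0 <= 2 * a * Q x by rewrite !mulr_ge0// ltW.
move: H H4 H5; rewrite H3 /Q.
move: (\sum_i F x i * J x i) (\sum_i x i * F x i) (q x) (p x) => S1 S2 Z P; lra.
Qed.

Variables (x : I -> R -> R) (t1 L : R).
Hypothesis L_gt0 : 0 < L.
Hypothesis x_cont : forall i, {within `[t1, t1 + L], continuous (x i)}.
Hypothesis x_derive : forall i t, t1 < t -> t < t1 + L -> is_derive t 1 (x i) (F (x ^~ t) i).

Let pt t := p (x ^~ t).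
Let qt t := q (x ^~ t).
Let Qt t := Q (x ^~ t).

Let pt_derive t : t1 < t -> t < t1 + L -> is_derive t 1 pt (2 * \sum_i x i t * F (x ^~ t) i).
Proof.
move=> h1 h2; rewrite mulr_sumr; apply: is_derive_fsum => i.
have D := x_derive i h1 h2.
by apply: is_derive_eq; rewrite /GRing.scale /=; ring.
Qed.

Let qt_derive t : t1 < t -> t < t1 + L ->
  is_derive t 1 qt (2 * \sum_i F (x ^~ t) i * J (x ^~ t) i).
Proof.
move=> h1 h2.
have -> : 2 * (\sum_i F (x ^~ t) i * J (x ^~ t) i) =
    \sum_i (x i t * J (F (x ^~ t)) i + J (x ^~ t) i * F (x ^~ t) i).
  have S1 := J_sym (x ^~ t) (F (x ^~ t)).
  have S2 : \sum_i J (x ^~ t) i * F (x ^~ t) i = \sum_i F (x ^~ t) i * J (x ^~ t) i.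
    by apply: eq_bigr => i _; rewrite mulrC.
  by rewrite big_split /= S2 S1; ring.
apply: is_derive_fsum => i.
have Di := x_derive i h1 h2.
have DJ : is_derive t 1 (fun s => J (x ^~ s) i) (J (F (x ^~ t)) i).
  apply: is_derive_fsum => j; have Dj := x_derive j h1 h2.
  by apply: is_derive_eq; rewrite /GRing.scale.
exact: is_deriveM.
Qed.

Let pt_cont : {within `[t1, t1 + L], continuous pt}.
Proof.
apply: within_continuous_fsum => i s; apply: cvgM; exact: x_cont.
Qed.

Let Qt_cont : {within `[t1, t1 + L], continuous Qt}.
Proof.
have qc : {within `[t1, t1 + L], continuous qt}.
  apply: within_continuous_fsum => i s; apply: cvgM; first exact: x_cont.
  apply: cvg_fsum => j; apply: cvgM; first exact: cvg_cst.
  by apply: cvgB; exact: x_cont.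
move=> s; apply: cvgB; last by apply: cvgM; [exact: cvg_cst | exact: pt_cont].
apply: cvgD; first exact: qc.
by apply: cvgM; [exact: cvg_cst | apply: cvgM; exact: pt_cont].
Qed.

(** If p stayed below eta^2, Q would remain positive, so p' >= a p >= a p(t1), and this linear
    growth already passes eta^2 within time L. The intermediate value theorem gives the exact level
    eta^2, which keeps the coordinates bounded at the exit time. *)
Lemma escape : p (x ^~ t1) < eta ^+ 2 ->
  0 < Q (x ^~ t1) -> eta ^+ 2 <= a * p (x ^~ t1) * L ->
  exists2 t, t1 <= t <= t1 + L & p (x ^~ t) = eta ^+ 2.
Proof.
rewrite -/(pt t1) -/(Qt t1) => pt1 Qt1 HL.
have t1L : t1 <= t1 + L by rewrite lerDl ltW.
have [[t [h1 h2 h3]]|N] := pselect (exists t, [/\ t1 <= t, t <= t1 + L & eta ^+ 2 <= pt t]).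
  have ct : {within `[t1, t], continuous pt}.
    apply: continuous_subspaceW pt_cont => s /=; rewrite !in_itv /= => /andP[-> /= st].
    exact: le_trans h2.
  have [s] := IVT (v := eta ^+ 2) h1 ct ltac:(by rewrite ge_min le_max (ltW pt1) h3 orbT).
  rewrite in_itv /= => /andP[s1 s2] E; exists s => //.
  by rewrite s1 (le_trans s2).
exfalso.
have small t : t1 <= t -> t <= t1 + L -> pt t < eta ^+ 2.
  by move=> h1 h2; rewrite ltNge; apply/negP => h3; apply: N; exists t.
have near_itv t (P : R -> Prop) : t1 <= t -> t < t1 + L ->
    (forall s, t < s -> t1 < s -> s < t1 + L -> P s) -> \forall s \near t^'+, P s.
  move=> h1 h2 H; apply: (@near_at_right _ _ _ (t1 + L - t)); first by rewrite subr_gt0.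
  move=> s ts sL; apply: H => //; first exact: le_lt_trans ts.
  by move: sL; rewrite addrC subrK.
have sub (g : R -> R) t : t <= t1 + L -> {within `[t1, t1 + L], continuous g} ->
    {within `[t1, t], continuous g}.
  move=> h2; apply: continuous_subspaceW => s /=; rewrite !in_itv /= => /andP[-> /= st].
  exact: le_trans h2.
have Qpos t : t1 <= t -> t <= t1 + L -> 0 < Qt t.
  move=> h1 h2; apply: (lt_le_trans Qt1); rewrite -lerN2.
  apply: (@right_derive_nincr _ (fun t => - Qt t)) => //.
    by apply: sub => // s; apply: cvgN; exact: Qt_cont.
  move=> s s1 s2; rewrite lerN2 => Qs.
  have [d d0 Hd] := within_continuousP Qt_cont
    (introT andP (conj s1 (ltW (lt_le_trans s2 h2)))) (e := Qt s) ltac:(lra).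
  have Hn : \forall r \near s^'+, r < s + d by apply: (@near_at_right _ _ _ d).
  apply: filterS2 Hn (near_itv s _ s1 (lt_le_trans s2 h2) (fun r a b c => conj a (conj b c))).
  move=> r rd [sr [r1 r2]].
  have Qr : 0 < Qt r.
    have := Hd r ltac:(apply/andP; lra) ltac:(rewrite ltr_distl; apply/andP; lra).
    by rewrite ltr_distl => /andP[]; lra.
  have D1 := pt_derive r1 r2; have D2 := qt_derive r1 r2.
  have DQ : is_derive r 1 Qt (2 * (\sum_i F (x ^~ r) i * J (x ^~ r) i) +
      (2 * k * pt r - a) * (2 * \sum_i x i r * F (x ^~ r) i)).
    rewrite /Qt /Q; apply: is_derive_eq; rewrite /GRing.scale /=; rewrite -/(pt r); ring.
  eexists; first exact: is_deriveN DQ.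
  rewrite oppr_le0; apply: Q_growth; last exact: ltW.
  exact: ltW (small r (ltW r1) (ltW r2)).
have pgrow t : t1 < t -> t < t1 + L -> 3 / 2 * a * pt t <= 2 * \sum_i x i t * F (x ^~ t) i.
  move=> h1 h2; apply: growth; first exact: ltW (small t (ltW h1) (ltW h2)).
  exact: ltW (Qpos t (ltW h1) (ltW h2)).
have ppos t : 0 <= pt t by exact: p_ge0.
have pincr t : t1 <= t -> t <= t1 + L -> pt t1 <= pt t.
  move=> h1 h2; rewrite -lerN2.
  apply: (@right_derive_nincr _ (fun t => - pt t)) => //.
    by apply: sub => // s; apply: cvgN; exact: pt_cont.
  move=> s s1 s2 _; apply: near_itv => //; first exact: lt_le_trans h2.
  move=> r sr r1 r2; have D := pt_derive r1 r2.
  eexists; first exact: is_deriveN D.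
  rewrite oppr_le0; apply: le_trans (pgrow r r1 r2).
  by rewrite mulr_ge0// mulr_ge0// ltW.
have : - pt (t1 + L) + a * pt t1 * (t1 + L) <= - pt t1 + a * pt t1 * t1.
  apply: (@right_derive_nincr _ (fun t => - pt t + a * pt t1 * t)) => //.
    move=> s; apply: cvgD; first by apply: cvgN; exact: pt_cont.
    by apply: cvgM; [exact: cvg_cst | apply: continuous_subspaceT => z; exact: cvg_id].
  move=> s s1 s2 _; apply: near_itv => // r sr r1 r2; have D := pt_derive r1 r2.
  exists (- (2 * \sum_i x i r * F (x ^~ r) i) + a * pt t1).
    by apply: is_derive_eq; rewrite /GRing.scale /= mulr1.
  have := pgrow r r1 r2; have := pincr r (ltW r1) (ltW r2).
  have := ppos r; rewrite addrC subr_le0 => h1 h2; apply: le_trans.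
  apply: (@le_trans _ _ (a * pt r)); first by rewrite ler_wpM2l// ltW.
  by have := mulr_ge0 (ltW a_gt0) h1; lra.
have := small (t1 + L) t1L (lexx _); have := ppos t1; lra.
Qed.

End Escape.

Section UnstableDirection.
Context {R : realType} {I : finType}.

Lemma unstable_direction (B : I -> I -> R) (v : I -> R) :
  (forall i j, B i j = B j i) ->
  0 < \sum_i v i * \sum_j B i j * (v j - v i) ->
  exists2 eta, 0 < eta <= 1 &
    forall s, 0 < s -> s ^+ 2 * (\sum_i v i ^+ 2) < eta ^+ 2 ->
    exists2 L, 0 < L &
      forall (t1 : R) (x : I -> R -> R),
        (forall i, {within `[t1, t1 + L], continuous (x i)}) ->
        (forall i t, t1 < t -> t < t1 + L ->
           is_derive t 1 (x i) (\sum_j B i j * sin (x j t - x i t))) ->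
        (forall i, x i t1 = s * v i) ->
        exists2 t, t1 <= t <= t1 + L & \sum_i x i t ^+ 2 = eta ^+ 2.
Proof.
move=> Bsym; set qv := \sum_i _ => qv0; pose pv := \sum_i v i ^+ 2.
have pv0 : 0 < pv.
  rewrite lt_neqAle sumr_ge0 ?andbT => [|i _]; last exact: sqr_ge0.
  apply/negP => /eqP pvE; move: qv0; rewrite /qv big1 ?ltxx// => i _.
  have : v i ^+ 2 <= pv by apply: (le_sum_term (h := fun i => v i ^+ 2)) => j; exact: sqr_ge0.
  rewrite -pvE => vi; have /eqP : v i ^+ 2 = 0 by apply/le_anti; rewrite vi sqr_ge0.
  by rewrite sqrf_eq0 => /eqP ->; rewrite mul0r.
(* Half the Rayleigh quotient of v: in the direction v, q = 2 a p, so Q >= a p > 0 at the start,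
   however small s is. *)
pose a := qv / (2 * pv).
have a0 : 0 < a by rewrite divr_gt0// mulr_gt0.
have qvE : qv = 2 * (a * pv) by rewrite /a; field; rewrite gt_eqF.
have := @escape R I B Bsym a a0.
set k := _ / (2 * a); set nc := #|I|%:R * (4 * _); set eta := a / _ => esc.
have nc0 : 0 <= nc.
  by rewrite mulr_ge0// mulr_ge0// sumr_ge0// => i _; rewrite sumr_ge0.
have k0 : 0 <= k.
  apply: divr_ge0; last by rewrite mulr_ge0// ltW.
  by apply: mulr_ge0 => //; exact: sqr_ge0.
have den0 : 0 < 4 * (k + nc) + 4 * a + 4 by lra.
have eta0 : 0 < eta by rewrite divr_gt0.
exists eta; first by rewrite eta0 ler_pdivrMr// mul1r; lra.
move=> s s0 sp.
have sp0 : 0 < s ^+ 2 * pv by rewrite mulr_gt0// exprn_gt0.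
exists (eta ^+ 2 / (a * (s ^+ 2 * pv))).
  by rewrite divr_gt0// ?exprn_gt0// mulr_gt0.
move=> t1 x cx dx x1.
have E1 : \sum_i x i t1 ^+ 2 = s ^+ 2 * pv.
  by rewrite mulr_sumr; apply: eq_bigr => i _; rewrite x1 exprMn.
have E2 : \sum_i x i t1 * \sum_j B i j * (x j t1 - x i t1) = s ^+ 2 * qv.
  rewrite mulr_sumr; apply: eq_bigr => i _; rewrite x1 expr2 mulrACA; congr (_ * _).
  by rewrite mulr_sumr; apply: eq_bigr => j _; rewrite !x1; ring.
apply: esc cx dx _ _ _; rewrite ?E1 ?E2//.
- by rewrite divr_gt0// ?exprn_gt0// mulr_gt0.
- rewrite qvE; have : 0 <= k * (s ^+ 2 * pv) ^+ 2 by rewrite mulr_ge0// sqr_ge0.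
  have : 0 < a * (s ^+ 2 * pv) by rewrite mulr_gt0.
  by move: (s ^+ 2) => s2; lra.
- by rewrite mulrCA divff ?mulr1// gt_eqF// mulr_gt0.
Qed.

End UnstableDirection.

(** * From lifts back to the torus *)

Section Transfer.
Context {R : realType} {I : finType}.
Implicit Types (A : R -> I -> I -> R) (M : I -> I -> R).

(** The pathwise interface between the two halves of the proof: probability establishes it almost
    surely, and the dynamics use nothing else about the coupling. *)
Definition driven A M (C : R) : Prop :=
  [/\ forall t, 0 <= t -> \forall s \near t^'+, forall i j, A s i j = A t i j,
      forall t i j, A t i j = A t j i,
      forall t i j, 0 <= A t i j <= C
    & forall T0 L : R, exists t,
       [/\ 0 <= t, T0 <= t & forall s, t <= s -> s < t + L -> forall i j, A s i j = M i j]].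

Lemma driven_sync (K : R) M : 0 < K ->
  (forall i j, connect (fun i j => 0 < M i j) i j) ->
  exists2 delta : R, 0 < delta & forall A C, driven A M C ->
    forall t0 (th : R -> I -> circle R), 0 <= t0 -> kuramoto_solution K A t0 th ->
    max_dist (th t0) (fun=> 0) < delta ->
    exists c : circle R, forall i, geo (th t i - (0 + c)) @[t --> +oo] --> (0 : R).
Proof.
move=> K0 conn; pose n : R := #|I|%:R.
have n0 : 0 <= n by [].
have d0 : 0 < 1 / (4 * (n + 1)) by rewrite divr_gt0// mulr_gt0// ltr_wpDl.
(* With this delta the initial sum of squares is at most n delta^2 < 1 / 16; n + 1 also covers an
   empty index set. *)
exists (1 / (4 * (n + 1))) => // A C [Astep Asym Age0 Awin] t0 th t00.
move=> [phi [phiE phi_cont phi_der]] dist.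
(* The components of the given lift may start near different multiples of 2 pi. Subtracting these
   gives lifts that start near 0 and solve the same equation. *)
have /choice[f fE] : forall i, exists zm : R * int,
    phi i t0 = zm.1 + zm.2%:~R * (pi *+ 2) /\ `|zm.1| < 1 / (4 * (n + 1)).
  move=> i; have [z zE zpi] := angle_small_repr (th t0 i).
  have [m mE] : exists m : int, phi i t0 = z + m%:~R * (pi *+ 2).
    by apply: angle_eqP; rewrite -zE phiE.
  exists (z, m); split=> //=; rewrite -geo_angle// -zE.
  apply: le_lt_trans dist.
  by have := geo_le_max_norm (fun i => th t0 i - 0) i; rewrite subr0.
pose psi i t := phi i t - (f i).2%:~R * (pi *+ 2).
have psiE i t : t0 <= t -> th t i = angle (psi i t).
  by move=> t0t; rewrite phiE// -(angle_period (psi i t) (f i).2) subrK.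
have psi_cont i : {within `[t0, +oo[, continuous (psi i)}.
  by move=> t; apply: cvgB; [exact: phi_cont | exact: cvg_cst].
have psi_der i t : t0 < t -> (\forall s \near t, forall j k, A s j k = A t j k) ->
    is_derive t 1 (psi i) (lift_field K (A t) (psi ^~ t) i).
  move=> t0t Hn; have D := phi_der i t t0t Hn.
  have -> : lift_field K (A t) (psi ^~ t) i = kuramoto_field K (A t) (th t) i.
    rewrite -kuramoto_field_angle; congr (kuramoto_field _ _ _ i).
    by apply/funext => j; rewrite psiE// ltW.
  by apply: is_derive_eq; rewrite subr0.
have init : \sum_i psi i t0 ^+ 2 < 1 / 16.
  apply: (@le_lt_trans _ _ (\sum_(i : I) (1 / (4 * (n + 1))) ^+ 2)).
    apply: ler_sum => i _; have [E H] := fE i.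
    rewrite /psi E addrK -real_normK ?num_real// ler_sqr ?nnegrE ?(ltW d0)//.
    exact: ltW.
  rewrite sum_cst -/n.
  have -> : n * (1 / (4 * (n + 1))) ^+ 2 = 1 / 16 * (n / (n + 1) ^+ 2).
    by field; rewrite gt_eqF// ltr_wpDl.
  rewrite gtr_pMr ?divr_gt0// ltr_pdivrMr ?exprn_gt0 ?ltr_wpDl// mul1r.
  by have := sqr_ge0 n; lra.
have [c Hc] := @lifts_synchronize R I K A M K0 Astep Asym
  (fun t i j => proj1 (andP (Age0 t i j))) conn Awin t0 psi t00 psi_cont psi_der init.
exists (angle c) => i; apply/cvgrPdist_le => e e0.
have [T HT] := Hc e e0.
near=> t.
rewrite sub0r normrN ger0_norm ?geo_ge0// add0r.
have t0t : t0 <= t by near: t; apply: nbhs_pinfty_ge; rewrite num_real.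
rewrite psiE// -angleB; apply: (le_trans (geo_angle_le _)); exact: HT.
Unshelve. all: by end_near. Qed.

Lemma driven_unstable (K : R) M (th_star : I -> circle R) : 0 < K ->
  (forall i j, connect (fun i j => 0 < M i j) i j) ->
  (forall i j, M i j = M j i) -> (forall i j, 0 <= M i j) ->
  phase_locked th_star -> ~ (forall i j, th_star i = th_star j) ->
  exists2 delta : R, 0 < delta & forall A C, driven A M C -> forall iota : R, 0 < iota ->
    exists t0, exists th : R -> I -> circle R,
        [/\ 0 <= t0, kuramoto_solution K A t0 th, max_dist (th t0) th_star < iota
          & delta < sup [set max_dist (th t) th_star | t in `[t0, +oo[]].
Proof.
move=> K0 conn Msym M0 locked /existsNP[i0 /existsNP[j0 ne]].
pose n : R := #|I|%:R.
have n1 : 1 <= n by rewrite /n ler1n; apply/card_gt0P; exists i0.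
have n0 : 0 < n by lra.
pose side i := `[< th_star i = th_star i0 >].
have [c0 c0E] := angle_repr (th_star i0).
pose c i : R := if side i then c0 else c0 + pi.
have cE i : th_star i = angle (c i).
  rewrite /c /side; case: asboolP => [->//|nE].
  have [/geo_eq0/eqP|/geo_eq_pi] := locked i i0; first by rewrite subr_eq0 => /eqP.
  by move=> E; rewrite angleD -c0E -E addrC subrK.
(* Around the phase-locked point the sine changes sign between the two clusters, so the deviations
   obey a system of the same form with the signed symmetric weights [B]. *)
pose S i j : R := if side i == side j then 1 else -1.
have sinS i j z : sin (c j - c i + z) = S i j * sin z.
  rewrite /c /S; case: (side i); case: (side j) => /=.
  - by rewrite subrr add0r mul1r.
  - by rewrite [c0 + pi]addrC addrK addrC sinDpi mulN1r.
  - by rewrite opprD addrA subrr sub0r addrC -[LHS]opprK -sinDpi subrK mulN1r.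
  - by rewrite subrr add0r mul1r.
pose B i j := K / n * M i j * S i j.
have Bsym i j : B i j = B j i by rewrite /B /S Msym eq_sym.
pose v i : R := (side i)%:R.
have Kn : 0 < K / n by rewrite divr_gt0.
have qv0 : 0 < \sum_i v i * \sum_j B i j * (v j - v i).
  rewrite (sum_antisym (g := fun i j => B i j * (v j - v i))); last first.
    by move=> i j; rewrite Bsym -mulrN opprB.
  (* v is constant on each cluster and S is -1 across, so only crossing edges contribute, each with
     the unstable sign. *)
  have term i j : (v j - v i) * (B i j * (v j - v i)) = - (K / n * M i j * (side i != side j)%:R).
    by rewrite /B /S /v; case: (side i); case: (side j) => /=; ring.
  have -> : \sum_i \sum_j (v j - v i) * (B i j * (v j - v i)) =
      - \sum_i \sum_j K / n * M i j * (side i != side j)%:R.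
    rewrite -sumrN; apply: eq_bigr => i _; rewrite -sumrN.
    by apply: eq_bigr => j _; exact: term.
  rewrite opprK divr_gt0//.
  (* Without a crossing edge, v would be constant by connectedness, although i0 and j0 lie in
     different clusters. *)
  have [i [j [Mij sij]]] : exists i j, 0 < M i j /\ side i != side j.
    apply: contrapT => /forallNP N.
    have sp := @connected_spread R I _ v 0 (lexx 0) conn.
    have /sp/(_ j0 i0) : forall i j, 0 < M i j -> `|v j - v i| <= 0.
      move=> i j Mij; rewrite /v; have [->|nij] := eqVneq (side i) (side j).
        by rewrite subrr normr0.
      by case: (N i); exists j.
    rewrite mulr0 /v /side; case: asboolP => // _; case: asboolP => [E|_].
      by case: ne.
    by rewrite subr0 normr1 ler10.
  have t0 i' j' : 0 <= K / n * M i' j' * (side i' != side j')%:R.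
    by rewrite mulr_ge0// mulr_ge0// ltW.
  apply: (@lt_le_trans _ _ (K / n * M i j * (side i != side j)%:R)).
    by rewrite sij mulr1 mulr_gt0.
  apply: (@le_trans _ _ (\sum_k K / n * M i k * (side i != side k)%:R)).
    exact: (le_sum_term (h := fun k => K / n * M i k * (side i != side k)%:R)).
  apply: (le_sum_term (h := fun i => \sum_k K / n * M i k * (side i != side k)%:R)).
  by move=> k; exact: sumr_ge0.
have [eta /andP[eta0 eta1] Heta] := unstable_direction Bsym qv0.
have pv : \sum_i v i ^+ 2 <= n.
  rewrite /n -[leRHS]mulr1 -sum_cst; apply: ler_sum => i _.
  by rewrite /v; case: (side i); rewrite ?expr1n ?expr0n.
have d0 : 0 < eta / (2 * n) by rewrite divr_gt0// mulr_gt0.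
(* If all deviations were at most eta / (2 n), their sum of squares would be at most eta^2 / (4 n),
   below the level eta^2 reached at the exit. *)
exists (eta / (2 * n)) => // A C [Astep Asym Age0 Awin] iota iota0.
pose s := Num.min (iota / 2) (eta / (2 * n)).
have s0 : 0 < s by rewrite lt_min d0 divr_gt0.
have dE : n * (eta / (2 * n)) ^+ 2 = eta ^+ 2 * (4 * n)^-1 by field; rewrite gt_eqF.
have dlt : n * (eta / (2 * n)) ^+ 2 < eta ^+ 2.
  rewrite dE gtr_pMr ?exprn_gt0// invf_lt1 ?mulr_gt0//; lra.
have sp : s ^+ 2 * (\sum_i v i ^+ 2) < eta ^+ 2.
  apply: le_lt_trans dlt; rewrite mulrC ler_pM// ?sqr_ge0//.
    by apply: sumr_ge0 => i _; exact: sqr_ge0.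
  by rewrite ler_sqr ?nnegrE ?(ltW s0) ?(ltW d0)// ge_min lexx orbT.
have [L L0 HL] := Heta s s0 sp.
(* The perturbation is released at the start of a window: t0 depends on the realization, as weak
   instability allows. *)
have [t0 [t00 _ win]] := Awin 0 L.
have AC t i j : `|A t i j| <= C by case/andP: (Age0 t i j) => h1 h2; rewrite ger0_norm.
have [phi [phi0 phi_cont phi_der]] := lift_exists K AC Astep (fun i => c i + s * v i) t00.
pose th t i := angle (phi i t).
(* Bounding [sup] from below requires an upper bound of the set, since [sup] of an unbounded set is
   a default value. *)
have dist_bounded : has_ubound [set max_dist (th t) th_star | t in `[t0, +oo[].
  exists pi => _ [t _ <-]; apply: max_norm_le; first exact: pi_ge0.
  by move=> i; exact: geo_le_pi.
exists t0, th; split=> //.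
- exists phi; split=> // [i|i t t0t Hn]; first by apply: continuous_subspaceT; exact: phi_cont.
  by rewrite kuramoto_field_angle; exact: phi_der.
- apply: (@le_lt_trans _ _ (iota / 2)); last by lra.
  apply: max_norm_le => [|i]; first by rewrite divr_ge0// ltW.
  rewrite /th cE -angleB phi0 addrC addKr; apply: (le_trans (geo_angle_le _)).
  rewrite normrM ger0_norm ?(ltW s0)//; apply: (@le_trans _ _ s).
    by rewrite ler_piMr ?(ltW s0)// /v; case: (side i); rewrite ?normr1 ?normr0.
  by rewrite ge_min lexx.
pose x i t := phi i t - c i.
have [t /andP[t0t tL] xt] : exists2 t, t0 <= t <= t0 + L & \sum_i x i t ^+ 2 = eta ^+ 2.
  apply: HL => [i|i t h1 h2|i].
  - apply: continuous_subspaceT => t; apply: cvgB; [exact: phi_cont | exact: cvg_cst].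
  - have Hn : \forall s \near t, forall j k, A s j k = A t j k.
      have : t \in `]t0, (t0 + L)[ by rewrite in_itv /= h1.
      move/near_in_itvoo; apply: filterS => r; rewrite in_itv /= => /andP[r1 r2] j k.
      by rewrite !win// ltW.
    have D := phi_der i t h1 Hn.
    have -> : \sum_j B i j * sin (x j t - x i t) = lift_field K (A t) (phi ^~ t) i.
      rewrite /lift_field mulr_sumr; apply: eq_bigr => j _.
      have -> : phi j t - phi i t = c j - c i + (x j t - x i t) by rewrite /x; ring.
      by rewrite sinS win ?(ltW h1)// /B; ring.
    by apply: is_derive_eq; rewrite subr0.
  - by rewrite /x phi0 addrC addKr.
have xle i : `|x i t| <= eta.
  rewrite -ler_sqr ?nnegrE ?(ltW eta0)// real_normK ?num_real// -xt.
  by apply: (le_sum_term (h := fun i => x i t ^+ 2)) => j; exact: sqr_ge0.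
have [i xi] : exists i, eta / (2 * n) < `|x i t|.
  apply: contrapT => /forallNP N; move: dlt; rewrite -xt -/n -sum_cst ltNge => /negP; apply.
  apply: ler_sum => i _; rewrite -real_normK ?num_real// ler_sqr ?nnegrE ?(ltW d0)//.
  by rewrite leNgt; apply/negP; exact: N.
apply: (lt_le_trans xi); apply: (@le_trans _ _ (max_dist (th t) th_star)).
  (* As eta <= 1 <= pi, the deviation of the lift is the geodesic distance itself. *)
  rewrite -geo_angle; last first.
    by apply: (le_trans (xle i)); apply: (le_trans eta1); have := pi_ge2 R; lra.
  have := geo_le_max_norm (fun i => th t i - th_star i) i.
  by rewrite /th cE -angleB.
by apply: ub_le_sup => //; exists t => //=; rewrite in_itv /= t0t.
Qed.

End Transfer.

(** * Recurrence of the Markov chains *)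

Section SemigroupBounds.
Context {R : realType} {S : finType}.
Variables (rate : S -> S -> R) (p : R -> S -> S -> R).
Hypothesis semi : is_transition_semigroup rate p.

Let p_ge0 (t : R) x y : 0 <= t -> 0 <= p t x y. Proof. by case: semi => H *; exact: H. Qed.
Let p_0 x : p 0 x x = 1. Proof. by case: semi => _ _ H _ _; rewrite H eqxx. Qed.

Lemma semigroup_mul_le (s t : R) x y z : 0 <= s -> 0 <= t -> p s x y * p t y z <= p (s + t) x z.
Proof.
move=> s0 t0; case: semi => _ _ _ H _; rewrite H//.
by apply: (le_sum_term (h := fun y => p s x y * p t y z)) => i; rewrite mulr_ge0 ?p_ge0.
Qed.

Lemma semigroup_exp_le (h : R) x k : 0 <= h -> p h x x ^+ k <= p (h *+ k) x x.
Proof.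
move=> h0; elim: k => [|k IH]; first by rewrite expr0 mulr0n p_0.
rewrite exprS mulrS; apply: le_trans (semigroup_mul_le x x x h0 _); last exact: mulrn_wge0.
by rewrite ler_wpM2l// p_ge0.
Qed.

(** The derivative at 0 gives the lower bound 1 - c h for small h. In general h is cut into N short
    steps that all stay at x, using 1 - y >= exp (- 2 y) for 0 <= y <= 1 / 2. *)
Lemma semigroup_hold x : exists C, forall h, 0 <= h -> expR (- (C * h)) <= p h x x.
Proof.
case: semi => _ _ _ _ gen; have G := gen x x.
set g := generator rate x x in G.
pose c := `|g| + 1.
have c0 : 0 < c by rewrite ltr_wpDl.
have [e e0 He] : exists2 e, 0 < e & forall h, 0 < h -> h < e -> 1 - c * h <= p h x x.
  have /cvgrPdist_lt/(_ 1 ltr01)/at_rightP[e e0 He] := G.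
  exists e => // h h0 he; have := He h h0; rewrite add0r => /(_ he).
  rewrite eqxx ltr_norml => /andP[_].
  rewrite ltrBlDr -ltrBlDl -[_ < _](ltr_pM2r h0) divfK ?gt_eqF//.
  have : - c * h <= (g - 1) * h.
    by rewrite ler_wpM2r ?(ltW h0)// /c; have := ler_norm (- g); rewrite normrN; lra.
  rewrite /=; lra.
exists (2 * c) => h; rewrite le_eqVlt => /orP[/eqP <-|h0]; first by rewrite mulr0 oppr0 expR0 p_0.
(* The first summand makes h / N < e, the second gives 2 c h / N <= 1. *)
pose N := (Num.truncn (h / e + 2 * c * h)).+1.
have N0 : (0 : R) < N%:R by [].
have HN : h / e + 2 * c * h < N%:R by exact: truncnS_gt.
have he0 : 0 < h / e by rewrite divr_gt0.
have ch0 : 0 < c * h by rewrite mulr_gt0.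
have hN0 : 0 < h / N%:R by rewrite divr_gt0.
have hNe : h / N%:R < e.
  by rewrite ltr_pdivrMr// mulrC -ltr_pdivrMr//; lra.
have chN : 2 * (c * (h / N%:R)) <= 1.
  by rewrite !mulrA ler_pdivrMr// mul1r; lra.
have small : expR (- (2 * c * (h / N%:R))) <= p (h / N%:R) x x.
  apply: le_trans (He _ hN0 hNe).
  set y := c * (h / N%:R) in chN *.
  have y0 : 0 < y by rewrite mulr_gt0.
  have E := expR_ge1Dx (2 * y).
  rewrite expRN -mulrA -/y; apply: (@le_trans _ _ (1 + 2 * y)^-1).
    by rewrite lef_pV2 ?posrE ?expR_gt0//; lra.
  rewrite -div1r ler_pdivrMr; last lra.
  have : 0 <= y * (1 - 2 * y) by rewrite mulr_ge0 ?(ltW y0)//; lra.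
  lra.
have -> : h = (h / N%:R) *+ N by rewrite -mulr_natr divfK// gt_eqF.
apply: le_trans (semigroup_exp_le x N (ltW hN0)).
have -> : - (2 * c * (h / N%:R *+ N)) = N%:R * (- (2 * c * (h / N%:R))).
  by rewrite -mulr_natl; ring.
by rewrite expRM_natl lerXn2r ?nnegrE ?expR_ge0// p_ge0// ltW.
Qed.

Lemma semigroup_diag_gt0 (t : R) x : 0 <= t -> 0 < p t x x.
Proof.
by move=> t0; have [C H] := semigroup_hold x; apply: lt_le_trans (H t t0); exact: expR_gt0.
Qed.

Lemma semigroup_step_gt0 (t : R) x y : 0 < t -> 0 < rate x y -> 0 < p t x y.
Proof.
move=> t0 rxy; have [->|xy] := eqVneq x y; first exact/semigroup_diag_gt0/ltW.
case: semi => _ _ _ _ gen; have G := gen x y.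
rewrite /generator (negbTE xy) mul0r subr0 in G.
have /cvgrPdist_lt/(_ _ rxy)/at_rightP[e e0 He] := G.
pose h := Num.min t e / 2.
have m0 : 0 < Num.min t e by rewrite lt_min t0.
have h0 : 0 < h by rewrite divr_gt0.
have m1 : Num.min t e <= t by rewrite ge_min lexx.
have m2 : Num.min t e <= e by rewrite ge_min lexx orbT.
have [ht he] : h < t /\ h < e by rewrite /h; split; lra.
have := He h h0; rewrite add0r => /(_ he).
rewrite subr0 ltr_norml => /andP[_].
rewrite ltrBlDr ltrDl pmulr_lgt0 ?invr_gt0// => phxy.
have -> : t = h + (t - h) by rewrite addrC subrK.
apply: lt_le_trans (semigroup_mul_le x y y (ltW h0) _); last by rewrite subr_ge0 ltW.
by rewrite mulr_gt0// semigroup_diag_gt0// subr_ge0 ltW.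
Qed.

Lemma semigroup_connect_gt0 (t : R) x y : 0 < t ->
  connect (fun x y => 0 < rate x y) x y -> 0 < p t x y.
Proof.
move=> + /connectP[l + ->]; elim: l x t => [|z l IH] x t t0 /=.
  by move=> _; exact/semigroup_diag_gt0/ltW.
move=> /andP[rxz lz]; rewrite [t]splitr.
have t2 : 0 < t / 2 by rewrite divr_gt0.
apply: lt_le_trans (semigroup_mul_le x z _ (ltW t2) (ltW t2)).
by apply: mulr_gt0; [exact: semigroup_step_gt0 | exact: IH].
Qed.

End SemigroupBounds.

Section PathProba.
Context {R : realType} {S : finType}.
Variable p : R -> S -> S -> R.
Implicit Types l : seq (R * S).

Lemma path_proba_cat (t u : R) (x y : S) l l' :
  path_proba p t x (l ++ (u, y) :: l') =
  path_proba p t x (rcons l (u, y)) * path_proba p u y l'.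
Proof.
by elim: l t x => [|[v z] l IH] t x /=; [rewrite mulr1 | rewrite IH mulrA].
Qed.

Definition grid (s h : R) (u : S) (m : nat) : seq (R * S) :=
  [seq (s + h *+ i, u) | i <- iota 0 m.+1].

Lemma grid_path (s h : R) u m t : t <= s -> 0 <= h ->
  path <=%R t [seq c.1 | c <- grid s h u m].
Proof.
rewrite /grid => ts h0.
have H k i v : v <= s + h *+ i ->
    path <=%R v [seq c.1 | c <- [seq (s + h *+ i, u) | i <- iota i k]].
  elim: k i v => [//|k IH] i v vi /=; rewrite vi /=.
  by apply: IH; rewrite mulrSr addrA lerDl.
by apply: H; rewrite mulr0n addr0.
Qed.

(** The bound depends on the total length h m but not on the number of points, so it survives
    refinement of the grid. *)
Lemma grid_proba (s h C t : R) (x u : S) m : 0 <= h ->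
  (forall r, 0 <= r -> expR (- (C * r)) <= p r u u) -> 0 <= p (s - t) x u ->
  p (s - t) x u * expR (- (C * (h *+ m))) <= path_proba p t x (grid s h u m).
Proof.
move=> h0 hold p0; rewrite /grid /= addr0 ler_wpM2l//.
have H k i : expR (- (C * (h *+ k))) <=
    path_proba p (s + h *+ i) u [seq (s + h *+ i, u) | i <- iota i.+1 k].
  elim: k i => [|k IH] i /=; first by rewrite mulr0n mulr0 oppr0 expR0.
  have -> : - (C * (h *+ k.+1)) = - (C * h) + - (C * (h *+ k)) by rewrite mulrS; ring.
  have -> : s + h *+ i.+1 - (s + h *+ i) = h by rewrite mulrS; ring.
  by rewrite expRD ler_pM ?expR_ge0 ?IH// hold.
by have := H m 0; rewrite mulr0n addr0.
Qed.

End PathProba.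

Section Visits.
Context {R : realType} {T : Type} {S : finType}.
Variable Z : R -> T -> S.
Implicit Types l : seq (R * S).

Lemma visits_nil : visits Z [::] = setT.
Proof. by apply/seteqP; split. Qed.

Lemma visits_cat l l' : visits Z (l ++ l') = visits Z l `&` visits Z l'.
Proof.
apply/seteqP; split=> om /=.
  by move=> H; split=> c cl; apply: H; rewrite mem_cat cl ?orbT.
by move=> [H1 H2] c; rewrite mem_cat => /orP[/H1|/H2].
Qed.

Lemma visits1 (t : R) (x : S) : visits Z [:: (t, x)] = [set om | Z t om = x].
Proof.
apply/seteqP; split=> om /=; first by move=> /(_ (t, x)); apply; exact: mem_head.
by move=> E c; rewrite inE => /eqP ->.
Qed.

Lemma visits_cons c l : visits Z (c :: l) = visits Z [:: c] `&` visits Z l.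
Proof. exact: (visits_cat [:: c]). Qed.

End Visits.

(* A Markov chain which is sent to [u] in unit time with probability at least
   [r], and which leaves [u] at bounded rate, fails to sit at [u] during n
   disjoint blocks with probability at most [(1 - q) ^ n].  A block is inspected
   on finer and finer dyadic grids. *)
Section Recurrence.
Context {R : realType} {d : measure_display} {T : measurableType d}.
Context (P : probability T R) {S : finType}.
Variables (Z : R -> T -> S) (p : R -> S -> S -> R) (z0 u : S) (C r : R).
Hypothesis p_ge0 : forall (s : R) x y, 0 <= s -> 0 <= p s x y.
Hypothesis mZ : forall (t : R) x, 0 <= t -> measurable [set om | Z t om = x].
Hypothesis law : forall l : seq (R * S), path <=%R 0 [seq c.1 | c <- l] ->
  P (visits Z l) = (path_proba p 0 z0 l)%:E.
Hypothesis hold : forall h, 0 <= h -> expR (- (C * h)) <= p h u u.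
Hypothesis reach : forall x, r <= p 1 x u.
Hypothesis r_gt0 : 0 < r.

Let Pr (A : set T) : R := fine (P A).

Let PrE A : measurable A -> P A = (Pr A)%:E.
Proof. by move=> mA; rewrite fineK// fin_num_measure. Qed.

Let Pr_ge0 A : 0 <= Pr A. Proof. exact: fine_ge0. Qed.

Let PrD A B : measurable A -> measurable B -> Pr (A `\` B) = Pr A - Pr (A `&` B).
Proof.
move=> mA mB; have mAB := measurableI _ _ mA mB; have mD := measurableD mA mB.
apply/eqP; rewrite eq_sym subr_eq; apply/eqP.
by apply: EFin_inj; rewrite EFinD -!PrE//; exact: measureDI.
Qed.

Let measurable_visits (l : seq (R * S)) :
  (forall c, c \in l -> 0 <= c.1) -> measurable (visits Z l).
Proof.
elim: l => [_|[t x] l IH H]; first by rewrite visits_nil.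
rewrite visits_cons; apply: measurableI.
  by rewrite visits1; apply: mZ; apply: (H (t, x)); exact: mem_head.
by apply: IH => c cl; apply: H; rewrite inE cl orbT.
Qed.

Let path_ge0 (s : R) (l : seq (R * S)) : 0 <= s -> path <=%R s [seq c.1 | c <- l] ->
  forall c, c \in l -> 0 <= c.1.
Proof.
move=> s0; rewrite le_path_sortedE => /andP[/allP H _] c cl.
by apply: (le_trans s0); apply: H; apply: map_f.
Qed.

Let total A (s : R) : measurable A -> 0 <= s -> Pr A = \sum_x Pr (A `&` visits Z [:: (s, x)]).
Proof.
move=> mA s0.
have mv x : measurable (visits Z [:: (s, x)]) by rewrite visits1; exact: mZ.
have H (e : seq S) : uniq e ->
    Pr (A `&` [set om | Z s om \in e]) = \sum_(x <- e) Pr (A `&` visits Z [:: (s, x)]) /\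
    measurable [set om | Z s om \in e].
  elim: e => [_|x e IH /= /andP[xe /IH[E mE]]].
    have -> : [set om | Z s om \in [::]] = set0 by apply/seteqP; split.
    by rewrite setI0 big_nil /Pr measure0.
  have US : [set om | Z s om \in x :: e] = visits Z [:: (s, x)] `|` [set om | Z s om \in e].
    apply/seteqP; split=> om; rewrite visits1 /= inE.
      by move=> /orP[/eqP|]; [left | right].
    by move=> [->|->]; rewrite ?eqxx ?orbT.
  have mU : measurable [set om | Z s om \in x :: e].
    by rewrite US; exact: measurableU.
  split=> //; rewrite big_cons -E; apply: EFin_inj.
  rewrite EFinD -!PrE; try exact: measurableI.
  rewrite US setIUr measureU//; try exact: measurableI.
  rewrite setIACA setIid [X in _ `&` X](_ : _ = set0) ?setI0//.
  apply/seteqP; split=> om //=; rewrite visits1 => -[/= ->].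
  by rewrite (negbTE xe).
have [E _] := H (index_enum S) (index_enum_uniq S).
rewrite -E; congr Pr; rewrite [X in _ `&` X](_ : _ = setT) ?setIT//.
by apply/seteqP; split=> om //= _; rewrite mem_index_enum.
Qed.

(** H acts as an event of the past of s: the Markov property given H, in product form so as not to
    divide by a null probability. It is stable under visits before a later time and under
    differences, the operations that build the failure events. *)
Let past (s : R) (H : set T) : Prop :=
  measurable H /\ forall z (l : seq (R * S)), path <=%R s [seq c.1 | c <- l] ->
    Pr (H `&` visits Z ((s, z) :: l)) = Pr (H `&` visits Z [:: (s, z)]) * path_proba p s z l.

Let past_setT s : 0 <= s -> past s setT.
Proof.
move=> s0; split=> // z l sl; rewrite !setTI /Pr !law/=; last by rewrite s0.
  by rewrite mulr1.
by rewrite s0.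
Qed.

(** Summing over the state at time s reduces the claim to the property of H; the path probabilities
    then split at (s', z). *)
Let past_visits s s' H (l : seq (R * S)) : 0 <= s -> past s H ->
  path <=%R s (rcons [seq c.1 | c <- l] s') -> past s' (H `&` visits Z l).
Proof.
move=> s0 [mH HH] sl.
have sl1 : path <=%R s [seq c.1 | c <- l] by move: sl; rewrite rcons_path => /andP[].
have ml : measurable (visits Z l) by apply: measurable_visits; exact: (path_ge0 s0).
have ss' : 0 <= s'.
  have := sl; rewrite le_path_sortedE => /andP[/allP/(_ s') + _].
  by rewrite mem_rcons mem_head => /(_ isT); exact: le_trans.
split=> [|z l' sl']; first exact: measurableI.
have key (l0 : seq (R * S)) : path <=%R s' [seq c.1 | c <- l0] ->
    Pr ((H `&` visits Z l) `&` visits Z ((s', z) :: l0)) =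
    (\sum_y Pr (H `&` visits Z [:: (s, y)]) * path_proba p s y (rcons l (s', z))) *
    path_proba p s' z l0.
  move=> sl0.
  have cat : path <=%R s [seq c.1 | c <- l ++ (s', z) :: l0].
    rewrite map_cat cat_path sl1 /= sl0 andbT.
    by move: sl; rewrite rcons_path => /andP[].
  rewrite -setIA -visits_cat (total _ s0); last first.
    by apply: measurableI => //; apply: measurable_visits; exact: (path_ge0 s0).
  rewrite mulr_suml; apply: eq_bigr => y _.
  rewrite -mulrA -path_proba_cat -HH//; congr Pr.
  by rewrite [in RHS]visits_cons -setIA; congr (_ `&` _); rewrite setIC.
by rewrite key// key// mulr1.
Qed.

Let past_later s s' H : 0 <= s -> s <= s' -> past s H -> past s' H.
Proof.
move=> s0 ss' HH; have := past_visits (l := [::]) (s' := s') s0 HH.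
by rewrite visits_nil setIT /= ss'; exact.
Qed.

Let past_setD s H E : measurable E -> past s H -> past s (H `&` E) -> 0 <= s -> past s (H `\` E).
Proof.
move=> mE [mH HH] [mHE HHE] s0; split=> [|z l sl]; first exact: measurableD.
have comm (A : set T) : (H `\` E) `&` A = (H `&` A) `\` E.
  by apply/seteqP; split=> om /= [[? ?] ?].
have comm2 (A : set T) : H `&` A `&` E = H `&` E `&` A by rewrite setIAC.
have m1 : measurable (visits Z ((s, z) :: l)).
  by apply: measurable_visits; apply: (path_ge0 (s := s) s0) => /=; rewrite lexx.
have m2 : measurable (visits Z [:: (s, z)]) by rewrite visits1; exact: mZ.
rewrite !comm !PrD//; try exact: measurableI.
by rewrite !comm2 HH// HHE// mulrBl.
Qed.

Let past_bound s H (l : seq (R * S)) q : 0 <= s -> past s H ->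
  path <=%R s [seq c.1 | c <- l] -> (forall y, q <= path_proba p s y l) ->
  q * Pr H <= Pr (H `&` visits Z l).
Proof.
move=> s0 [mH HH] sl Hq.
have ml : measurable (visits Z l) by apply: measurable_visits; exact: (path_ge0 s0).
rewrite (total mH s0) (total (measurableI _ _ mH ml) s0) mulr_sumr.
apply: ler_sum => y _.
rewrite -setIA [visits Z l `&` _]setIC -visits_cons (HH y l sl).
by rewrite mulrC ler_wpM2l.
Qed.

Variables (T0 L : R).
Hypotheses (T0_ge0 : 0 <= T0) (L_gt0 : 0 < L).

(** Unit time to reach u from any state, then a time L to stay there. *)
Let start k := T0 + (1 + L) *+ k.
Let block k j := grid (start k + 1) (L / (2 ^ j)%:R) u (2 ^ j).
Let fail_all j := fix F k := if k is k'.+1 then F k' `\` visits Z (block k' j) else setT.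
Let q := r * expR (- (C * L)).

Let start_ge0 k : 0 <= start k.
Proof. by rewrite addr_ge0// mulrn_wge0// addr_ge0// ltW. Qed.

Let startS k : start k.+1 = start k + 1 + L.
Proof. by rewrite /start mulrSr !addrA. Qed.

Let step_ge0 j : 0 <= L / (2 ^ j)%:R. Proof. by rewrite divr_ge0// ltW. Qed.

Let step_full j : (L / (2 ^ j)%:R) *+ 2 ^ j = L.
Proof. by rewrite -mulr_natr divfK// pnatr_eq0 expn_eq0. Qed.

Let block_mem k j c : c \in block k j ->
  exists2 i, (i <= 2 ^ j)%N & c = (start k + 1 + (L / (2 ^ j)%:R) *+ i, u).
Proof. by move=> /mapP[i]; rewrite mem_iota ltnS => /andP[_ ij] ->; exists i. Qed.

Let block_path k j : path <=%R (start k) (rcons [seq c.1 | c <- block k j] (start k.+1)).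
Proof.
rewrite rcons_path grid_path ?lerDl//=.
rewrite (last_nth (start k)) size_map size_map size_iota.
rewrite -[nth _ _ _]/(nth (start k) [seq c.1 | c <- block k j] (2 ^ j)).
rewrite -map_comp (nth_map 0%N) ?size_iota// nth_iota//= add0n step_full startS.
exact: lexx.
Qed.

Let block_path' k j : path <=%R (start k) [seq c.1 | c <- block k j].
Proof. by have := block_path k j; rewrite rcons_path => /andP[]. Qed.

Let block_proba k j y : q <= path_proba p (start k) y (block k j).
Proof.
have E : start k + 1 - start k = 1 by rewrite addrC addKr.
have := @grid_proba R S p (start k + 1) (L / (2 ^ j)%:R) C (start k) y u (2 ^ j)
  (step_ge0 j) hold.
rewrite E step_full => /(_ (p_ge0 _ _ ler01)); apply: le_trans.
by rewrite ler_wpM2r// expR_ge0.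
Qed.

Let measurable_block k j : measurable (visits Z (block k j)).
Proof. by apply: measurable_visits; exact: (path_ge0 (start_ge0 k) (block_path' k j)). Qed.

Let past_fail j k : past (start k) (fail_all j k).
Proof.
elim: k => [|k IH]; first exact: (past_setT (start_ge0 0)).
have ss : start k <= start k.+1 by rewrite startS -addrA lerDl addr_ge0// ltW.
apply: past_setD => //; first exact: (past_later (start_ge0 k) ss IH).
exact: (past_visits (start_ge0 k) IH (block_path k j)).
Qed.

Let q_gt0 : 0 < q. Proof. by rewrite mulr_gt0// expR_gt0. Qed.

Let q_le1 : q <= 1.
Proof.
have := past_bound (start_ge0 0) (past_setT (start_ge0 0)) (block_path' 0 0) (block_proba 0 0).
have -> : Pr setT = 1 by rewrite /Pr probability_setT.
rewrite mulr1 setTI => /le_trans; apply.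
by rewrite -lee_fin -PrE; [exact: probability_le1|].
Qed.

Let fail_bound j k : Pr (fail_all j k) <= (1 - q) ^+ k.
Proof.
elim: k => [|k IH]; first by rewrite /Pr probability_setT expr0.
have [mF _] := past_fail j k.
rewrite /= PrD// exprS.
have := past_bound (start_ge0 k) (past_fail j k) (block_path' k j) (block_proba k j).
have : (1 - q) * Pr (fail_all j k) <= (1 - q) * (1 - q) ^+ k.
  by rewrite ler_wpM2l// subr_ge0.
by lra.
Qed.

Let block_mono k j : visits Z (block k j.+1) `<=` visits Z (block k j).
Proof.
move=> om H c /block_mem[i ij ->]; apply: H; apply/mapP; exists i.*2.
  by rewrite mem_iota add0n /= ltnS expnS mul2n leq_double.
congr (_ + _, _); rewrite -mul2n mulrnA; congr (_ *+ i).
by rewrite expnS natrM -mulr_natr; field; rewrite pnatr_eq0 expn_eq0.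
Qed.

Let block_mono_le k j j' : (j <= j')%N -> visits Z (block k j') `<=` visits Z (block k j).
Proof.
move=> /subnK <-; elim: (j' - j)%N => [//|m IH]; rewrite addSn.
exact: subset_trans (@block_mono k _) IH.
Qed.

Let fail_mono k j j' : (j <= j')%N -> fail_all j k `<=` fail_all j' k.
Proof.
move=> jj'; elim: k => [//|k IH /=] om [/IH ? nv]; split=> // /(block_mono_le jj').
exact: nv.
Qed.

(** Failure on a grid persists on its refinements, so these events increase with j and the bound,
    uniform in j, passes to the union. *)
Let fail_ever k := \bigcup_j fail_all j k.

Let measurable_ever k : measurable (fail_ever k).
Proof. by apply: bigcup_measurable => j _; have [] := past_fail j k. Qed.

Let ever_bound k : Pr (fail_ever k) <= (1 - q) ^+ k.
Proof.
rewrite -lee_fin -PrE//.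
have mF j : measurable (fail_all j k) by have [] := past_fail j k.
have nd : nondecreasing_seq (fail_all ^~ k).
  by move=> j j' jj'; apply/subsetPset; exact: fail_mono.
have H := nondecreasing_cvg_mu mF (measurable_ever k) nd (mu := P).
rewrite -(cvg_lim _ H)//; apply: lime_le; first by apply/cvg_ex; eexists; exact: H.
by apply: nearW => j /=; rewrite PrE// lee_fin.
Qed.

Lemma recurrence : {ae P, forall om, exists k, forall j, visits Z (block k j) om}.
Proof.
have mB : measurable (\bigcap_k fail_ever k) by exact: bigcapT_measurable.
exists (\bigcap_k fail_ever k); split=> //.
  rewrite PrE//; congr EFin; apply/le_anti; rewrite Pr_ge0 andbT leNgt; apply/negP => B0.
  have : `|1 - q| < 1 by rewrite ger0_norm ?subr_ge0// ltrBlDr ltrDl.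
  move/cvg_expr => /cvgrPdist_lt/(_ _ B0)[k _ /(_ k (leqnn k))].
  rewrite /= sub0r normrN ger0_norm ?exprn_ge0 ?subr_ge0// ltNge => /negP; apply.
  apply: le_trans (ever_bound k); rewrite -lee_fin -!PrE//.
  by apply: le_measure; rewrite ?inE//; exact: bigcap_inf.
move=> om /= /forallNP N k _.
elim: k => [|k [j _ jF]]; first by exists 0%N.
have /existsNP[j' nv] := N k.
exists (maxn j j') => //=; split; first by apply: fail_mono jF; exact: leq_maxl.
by move=> /(block_mono_le (leq_maxr j j')).
Qed.

(* Right-continuity upgrades the dyadic grid of a successful block to an interval. *)
Lemma recurrence_window :
  {ae P, forall om, (forall t, 0 <= t -> \forall s \near t^'+, Z s om = Z t om) ->
    exists t, [/\ 0 <= t, T0 <= t & forall s, t <= s -> s < t + L -> Z s om = u]}.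
Proof.
apply: filterS recurrence => om [k Hk] rc.
exists (start k + 1).
have k1 : 0 <= start k + 1 by rewrite addr_ge0.
split=> // [|s ks sL].
  by rewrite -addrA lerDl addr_ge0// mulrn_wge0// addr_ge0// ltW.
have s0 : 0 <= s by exact: le_trans ks.
have [e e0 He] := at_rightP (rc s s0).
pose e' := Num.min e (start k + 1 + L - s).
have e'0 : 0 < e' by rewrite lt_min e0 subr_gt0.
have [j _ /(_ j (leqnn j))] := near_infty_natSinv_expn_lt (PosNum (divr_gt0 e'0 L_gt0)).
rewrite /= div1r ltr_pdivlMr// mulrC -natrX => jL.
pose h := L / (2 ^ j)%:R.
have h0 : 0 < h by rewrite divr_gt0// ltr0n expn_gt0.
(* Index of the first grid point strictly after s; h is small enough for it to lie in the block and
   in the right neighbourhood of s where Z is constant. *)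
pose i := (Num.truncn ((s - (start k + 1)) / h)).+1.
have sh0 : 0 <= (s - (start k + 1)) / h by rewrite divr_ge0 ?subr_ge0// ltW.
have /andP[i1 i2] := truncn_itv sh0.
rewrite -/i in i2.
have si : s < start k + 1 + h *+ i.
  by move: i2; rewrite ltr_pdivrMr// ltrBlDl mulr_natl.
have is_ : start k + 1 + h *+ i <= s + h.
  move: i1; rewrite ler_pdivlMr// lerBrDl mulr_natl mulrSr addrA lerD2r; exact.
have he : h < e by apply: (lt_le_trans jL); rewrite ge_min lexx.
have hL : h < start k + 1 + L - s by apply: (lt_le_trans jL); rewrite ge_min lexx orbT.
have ij : (i <= 2 ^ j)%N.
  rewrite -(ler_nat R) -(ler_pM2l h0) [h * (2 ^ j)%:R]divfK ?pnatr_eq0 ?expn_eq0//.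
  by rewrite mulr_natr; lra.
have Zi : Z (start k + 1 + h *+ i) om = u.
  apply: (Hk j (start k + 1 + h *+ i, u)); apply/mapP; exists i => //.
  by rewrite mem_iota add0n ltnS.
by rewrite -Zi; apply/esym/He => //; apply: (le_lt_trans is_); rewrite ltrD2l.
Qed.

End Recurrence.

(** * From one chain to several independent ones *)

Section SimultaneousWindows.
Context {R : realType} {d : measure_display} {T : measurableType d}.
Context (P : probability T R) {J S : finType}.
Variables (rate : S -> S -> R) (x0 : J -> S) (X : J -> R -> T -> S) (u : S).
Hypothesis chain : forall j, is_markov_chain P rate (x0 j) (X j).
Hypothesis indep : independent_processes P [set: J]%SET X.
Hypothesis conn : forall x, connect (fun x y => 0 < rate x y) x u.

(** The joint process as one process on a finite product. By independence its finite-dimensional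
    laws are path probabilities of the product kernel, so the recurrence of a single process
    applies. *)
Let Z (s : R) (om : T) : {ffun J -> S} := [ffun j => X j s om].

Let coord (l : seq (R * {ffun J -> S})) (j : J) : seq (R * S) := 
  [seq (c.1, (c.2 : {ffun J -> S}) j) | c <- l].

Let visitsE l : visits Z l = [set om | forall j, j \in [set: J]%SET -> visits (X j) (coord l j) om].
Proof.
apply/seteqP; split=> om /=.
  by move=> H j _ c /mapP[c' /H cl ->] /=; rewrite -cl ffunE.
move=> H c cl; apply/ffunP => j; rewrite ffunE.
have /= -> // := H j (finset.in_setT _) (c.1, c.2 j).
by apply/mapP; exists c.
Qed.

Let path_proba_prod (p : J -> R -> S -> S -> R) (t : R) (z : {ffun J -> S}) l :
  path_proba (fun s (z z' : {ffun J -> S}) => \prod_j p j s (z j) (z' j)) t z l =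
  \prod_j path_proba (p j) t (z j) (coord l j).
Proof.
elim: l t z => [|[s z'] l IH] t z /=; first by rewrite big1.
by rewrite IH -big_split.
Qed.

Lemma simultaneous_windows :
  {ae P, forall om,
    (forall t, 0 <= t -> \forall s \near t^'+, forall j, X j s om = X j t om) /\
    forall T0 L : R, exists t,
      [/\ 0 <= t, T0 <= t & forall s, t <= s -> s < t + L -> forall j, X j s om = u]}.
Proof.
have /choice[p Hp] : forall j, exists p, is_transition_semigroup rate p /\
    forall l : seq (R * S), path <=%R 0 [seq c.1 | c <- l] ->
      P (visits (X j) l) = (path_proba p 0 (x0 j) l)%:E.
  by move=> j; have [_ _ [p sp lp]] := chain j; exists p.
pose pj (s : R) (z z' : {ffun J -> S}) := \prod_j p j s (z j) (z' j).
pose z0 : {ffun J -> S} := [ffun j => x0 j].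
pose U : {ffun J -> S} := [ffun=> u].
have pj_ge0 (s : R) x y : 0 <= s -> 0 <= pj s x y.
  by move=> s0; apply: prodr_ge0 => j _; have [[H _ _ _ _] _] := Hp j; exact: H.
have mX j (t : R) x : 0 <= t -> measurable [set om | X j t om = x].
  by move=> t0; have [H _ _] := chain j; exact: H.
have mZ (t : R) x : 0 <= t -> measurable [set om | Z t om = x].
  move=> t0; have -> : [set om | Z t om = x] = \bigcap_(j in [set: J]) [set om | X j t om = x j].
    apply/seteqP; split=> om /=; first by move=> <- j _ /=; rewrite ffunE.
    by move=> H; apply/ffunP => j; rewrite ffunE; exact: H.
  by apply: fin_bigcap_measurable => // j _; exact: mX.
have law (l : seq (R * {ffun J -> S})) : path <=%R 0 [seq c.1 | c <- l] ->
    P (visits Z l) = (path_proba pj 0 z0 l)%:E.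
  move=> sl.
  have tE j : [seq c.1 | c <- coord l j] = [seq c.1 | c <- l].
    by rewrite -map_comp; apply: eq_map => -[].
  rewrite visitsE indep => [|j c cl].
    rewrite path_proba_prod -prodEFin; under eq_bigl do rewrite finset.in_setT.
    apply: eq_bigr => j _; have [_ ->] := Hp j; last by rewrite tE.
    by rewrite ffunE.
  have := sl; rewrite -(tE j) le_path_sortedE => /andP[/allP H _].
  by apply: H; exact: map_f.
have /choice[Cj HC] : forall j, exists C, forall h, 0 <= h -> expR (- (C * h)) <= p j h u u.
  by move=> j; have [sp _] := Hp j; exact: semigroup_hold sp u.
have hold h : 0 <= h -> expR (- ((\sum_j Cj j) * h)) <= pj h U U.
  move=> h0; rewrite mulr_suml -sumrN expR_sum; apply: ler_prod => j _.
  by rewrite expR_ge0 !ffunE HC.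
have [r r0 Hr] := positive_lower_bound (fun z => pj 1 z U).
have reach z : r <= pj 1 z U.
  apply: Hr; apply: prodr_gt0 => j _; have [sp _] := Hp j.
  by rewrite ffunE; apply: (semigroup_connect_gt0 sp ltr01); exact: conn.
(* Integer bounds keep the exceptional null sets countable in number; real T0 and L follow by
   rounding up. *)
have win : {ae P, forall om, forall a b : nat,
    (forall t, 0 <= t -> \forall s \near t^'+, Z s om = Z t om) ->
    exists t, [/\ 0 <= t, a%:R <= t & forall s, t <= s -> s < t + b.+1%:R -> Z s om = U]}.
  apply: ae_foralln => a; apply: ae_foralln => b.
  exact: (recurrence_window pj_ge0 mZ law hold reach r0).
have cad : {ae P, forall om, forall j, cadlag_path (fun t => X j t om)}.
  by apply: filter_forall => j; have [_ H _] := chain j.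
apply: filterS2 win cad => om Hw Hc.
have step t : 0 <= t -> \forall s \near t^'+, forall j, X j s om = X j t om.
  by move=> t0; apply: filter_forall => j; have [] := Hc j t t0.
split=> // T0 L.
have [] := Hw (Num.truncn (Num.max 0 T0)).+1 (Num.truncn (Num.max 0 L)).
  by move=> t t0; apply: filterS (step t t0) => s H; apply/ffunP => j; rewrite !ffunE.
move=> t [t0 tT tL]; exists t; split=> //.
  apply: le_trans tT; apply: ltW; apply: le_lt_trans (truncnS_gt _).
  by rewrite le_max lexx orbT.
move=> s ts sL j; have := tL s ts; rewrite /Z.
have sL' : s < t + (Num.truncn (Num.max 0 L)).+1%:R.
  apply: (lt_le_trans sL); rewrite lerD2l; apply: ltW; apply: le_lt_trans (truncnS_gt _).
  by rewrite le_max lexx orbT.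
by move=> /(_ sL')/ffunP/(_ j); rewrite !ffunE.
Qed.

End SimultaneousWindows.

(** Only edges carry chains, so the edge processes are reindexed by a subtype on which every index
    has one. *)
Lemma independent_sub {R : realType} {d : measure_display} {T : measurableType d}
    (P : probability T R) {J S : finType} (D : {set J}) (X : J -> R -> T -> S) :
  independent_processes P D X ->
  independent_processes P [set: {j | j \in D}]%SET (fun j => X (val j)).
Proof.
move=> indep l Hl.
pose l' j := if insub j is Some j' then l j' else [::].
have l'E (j : {j | j \in D}) : l' (val j) = l j by rewrite /l' valK.
have := indep l'.
rewrite [X in P X](_ : _ = [set om | forall j : {j | j \in D}, j \in [set: {j | j \in D}]%SET ->
  visits (X (val j)) (l j) om]).
  move=> ->; last by move=> j c; rewrite /l'; case: insubP => // j' _ _; exact: Hl.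
  under [RHS]eq_bigl do rewrite finset.in_setT.
  by rewrite big_sub; apply: eq_bigr => j _; rewrite l'E.
apply/seteqP; split=> om /= H.
  by move=> j _; rewrite -l'E; apply: H; exact: valP.
by move=> j jD; have := H (exist (fun j => j \in D) j jD) (finset.in_setT _); rewrite -l'E.
Qed.

(** * Pathwise properties of the two models *)

Section Couplings.
Context {R : realType} {d : measure_display} {T : measurableType d}.
Context (P : probability T R) {V : finType} (w : V -> V -> R).
Hypothesis hw : is_weighted_graph w.

Let w_le_sum i j : w i j <= \sum_i \sum_j w i j.
Proof.
have [_ w0 _ _] := hw.
apply: (@le_trans _ _ (\sum_j w i j)); first exact: (le_sum_term (h := w i)).
by apply: (le_sum_term (h := fun i => \sum_j w i j)) => k; exact: sumr_ge0.
Qed.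

Lemma KRW_driven (N : nat) (eps : R) (x0 : 'I_N -> V) (X : 'I_N -> R -> T -> V) (u : V) :
  0 < eps -> is_KRW P w eps x0 X ->
  {ae P, forall om, driven (KRW_coupling w X om) (fun _ _ => w u u) (\sum_i \sum_j w i j)}.
Proof.
move=> eps0 [chain indep]; have [wsym w0 wpos wconn] := hw.
have conn x : connect (fun x y => 0 < walk_rate w eps x y) x u.
  have := wconn x u; apply: connect_sub => y z wyz; apply: connect1.
  by rewrite mulr_gt0 ?invr_gt0// divr_gt0.
apply: filterS (simultaneous_windows chain indep conn) => om [step win].
split=> [t t0|t i j|t i j|T0 L].
- by apply: filterS (step t t0) => s H i j; rewrite /KRW_coupling !H.
- exact: wsym.
- by rewrite w0 w_le_sum.
have [t [t0 tT tL]] := win T0 L; exists t; split=> // s ts sL i j.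
by rewrite /KRW_coupling !tL.
Qed.

Lemma DRC_driven (eps kappa : R) (Y : {set V} -> R -> T -> bool) :
  0 < kappa -> is_DRC P w eps kappa Y ->
  {ae P, forall om, driven (DRC_coupling w Y om) w (\sum_i \sum_j w i j)}.
Proof.
move=> kappa0 [chain indep]; have [wsym w0 wpos wconn] := hw.
pose J := {e : {set V} | e \in edges w}.
have conn x : connect (fun x y => 0 < edge_rate eps kappa x y) x true.
  by case: x; [exact: connect0 | exact: connect1].
have chain' (e : J) : is_markov_chain P (edge_rate eps kappa) true (Y (val e)).
  by apply: chain; exact: valP.
apply: filterS (simultaneous_windows chain' (independent_sub indep) conn) => om [step win].
split=> [t t0|t i j|t i j|T0 L].
- apply: filterS (step t t0) => s H i j; rewrite /DRC_coupling; congr (_%:R * _).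
  have E r : ([set i; j]%SET \in open_edges w Y om r) =
    ([set i; j]%SET \in edges w) && Y [set i; j]%SET r om by rewrite finset.in_set.
  rewrite !E; case: (boolP (_ \in edges w)) => //= eE.
  by have /= -> := H (exist (fun e => e \in edges w) _ eE).
- by rewrite /DRC_coupling finset.setUC wsym.
- rewrite /DRC_coupling; case: (_ \in _); rewrite ?mul1r ?mul0r ?w0 ?w_le_sum ?lexx//.
  by rewrite sumr_ge0// => k _; exact: sumr_ge0.
have [t [t0 tT tL]] := win T0 L; exists t; split=> // s ts sL i j.
rewrite /DRC_coupling; have [wij|wij] := ltP 0 (w i j); last first.
  by rewrite (le_anti (introT andP (conj wij (w0 i j)))) mulr0.
have eE : [set i; j]%SET \in edges w.
  by rewrite finset.in_set; apply/existsP; exists i; apply/existsP; exists j; rewrite eqxx.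
have /= Ye := tL s ts sL (exist (fun e => e \in edges w) _ eE).
by rewrite finset.in_set eE Ye mul1r.
Qed.

End Couplings.

Section AlmostSure.
Context {R : realType} {I : finType} {d : measure_display} {T : measurableType d}.
Context (P : probability T R) (K : R) (A : T -> R -> I -> I -> R) (M : I -> I -> R) (C : R).
Hypothesis K_gt0 : 0 < K.
Hypothesis M_conn : forall i j, connect (fun i j => 0 < M i j) i j.
Hypothesis A_driven : {ae P, forall om, driven (A om) M C}.

Lemma ae_driven_stable : asymptotically_stable P K A (fun=> 0).
Proof.
have [delta d0 H] := driven_sync K_gt0 M_conn; exists delta => // t0 t00.
by apply: filterS A_driven => om Hom th sol dist; exact: (H _ _ Hom t0).
Qed.

Lemma ae_driven_unstable (th : I -> circle R) :
  (forall i j, M i j = M j i) -> (forall i j, 0 <= M i j) ->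
  phase_locked th -> ~ (forall i j, th i = th j) -> weakly_unstable P K A th.
Proof.
move=> Msym M0 locked ne.
have [delta d0 H] := driven_unstable K_gt0 M_conn Msym M0 locked ne.
exists delta => // iota iota0.
by apply: filterS A_driven => om Hom; exact: (H _ _ Hom).
Qed.

End AlmostSure.

Theorem proposition2p2 (R : realType) (d : measure_display)
    (T : measurableType d) (P : probability T R)
    (V : finType) (w : V -> V -> R) (K : R)
    (hw : is_weighted_graph w) (hK : 0 < K) :
  (forall (N : nat) (eps : R) (x0 : 'I_N -> V) (X : 'I_N -> R -> T -> V),
     (2 <= N)%N -> 0 < eps -> (forall u, 0 < w u u) ->
     is_KRW P w eps x0 X ->
     (forall th : 'I_N -> circle R, phase_locked th ->
        ~ (forall i j, th i = th j) ->
        weakly_unstable P K (KRW_coupling w X) th) /\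
     asymptotically_stable P K (KRW_coupling w X) (fun=> 0)) /\
  (forall (eps kappa : R) (Y : {set V} -> R -> T -> bool),
     0 < eps -> 0 < kappa ->
     is_DRC P w eps kappa Y ->
     (forall th : V -> circle R, phase_locked th ->
        ~ (forall u v, th u = th v) ->
        weakly_unstable P K (DRC_coupling w Y) th) /\
     asymptotically_stable P K (DRC_coupling w Y) (fun=> 0)).
Proof.
have [wsym w0 wpos wconn] := hw.
split=> [N eps x0 X N2 eps0 loops krw|eps kappa Y eps0 kappa0 drc].
  (* Any vertex can be the meeting point; the start of a walker names one. Its self-loop makes the
     constant [w u u] positive, so all pairs of walkers are joined. *)
  pose u := x0 (Ordinal (ltnW N2)).
  have drv := KRW_driven hw u eps0 krw.
  have conn (i j : 'I_N) : connect (fun _ _ => 0 < w u u) i j by exact: connect1.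
  split; last exact: ae_driven_stable hK conn drv.
  by move=> th locked ne; exact: (ae_driven_unstable hK conn drv).
have drv := DRC_driven hw kappa0 drc.
split; last exact: ae_driven_stable hK wconn drv.
by move=> th locked ne; exact: (ae_driven_unstable hK wconn drv).
Qed.
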